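(* Assume that $T$ is monadically NIP, that $\downarrow$ is a bounded standard preindependence relation, that the small set $A$ is an extension base for $\downarrow$, and that $\downarrow$ satisfies left extension over $A$. Then $\downarrow$ satisfies BS-triviality over $A$: for all tuples $\bar a,\bar b$ with $\bar b\downarrow_A\bar a$ and every singleton $c$, either $\bar b c\downarrow_A\bar a$ or $\bar b\downarrow_A\bar a c$.
   Context: $T$ is a complete first-order theory and $\mathbb{M}\models T$ is a sufficiently saturated and homogeneous monster model; ''small'' means of size less than the saturation of $\mathbb{M}$. Tuples are small tuples of elements of $\mathbb{M}$ (possibly infinite unless said otherwise), a singleton is a single element, parameter sets are small subsets of $\mathbb{M}$, and juxtaposition denotes concatenation / union; tuples are identified with the sets they enumerate when convenient. $T$ is monadically NIP if every expansion of every model of $T$ by unary predicates is NIP. Let $\downarrow$ be a relation on triples of small subsets of $\mathbb{M}$, written $a\downarrow_A b$ (its negation is written $a\not\downarrow_A b$). It is a standard preindependence relation if it satisfies: (1) Invariance: $a\downarrow_A b$ and $\sigma\in\operatorname{Aut}(\mathbb{M})$ imply $\sigma(a)\downarrow_{\sigma(A)}\sigma(b)$. (2) Monotonicity: $aa'\downarrow_A bb'$ implies $a\downarrow_A b$. (3) Strong finite character: if $a\not\downarrow_A b$, there is a formula $\varphi(x)\in\operatorname{tp}(a/Ab)$ such that $a'\not\downarrow_A b$ for every $a'\models\varphi(x)$. (4) Base monotonicity: $a\downarrow_A bc$ implies $a\downarrow_{Ab}c$. (5) Left transitivity: $a\downarrow_{Ab}c$ and $b\downarrow_A c$ imply $ab\downarrow_A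 c$. (6) Right extension: if $a\downarrow_A b$, then for every $c$ there is $c'\equiv_{Ab}c$ with $a\downarrow_A bc'$. Left extension over $A$: if $a\downarrow_A b$, then for every $c$ there is $c'\equiv_{Aa}c$ with $ac'\downarrow_A b$. $\downarrow$ is bounded if there is a function $f$ on cardinals such that for every small set $C$, every $p(x)\in S(C)$ with $x$ a finite tuple of variables, and every small $D\supseteq C$, the set $\{\operatorname{tp}(a/D): a\models p,\ a\downarrow_C D\}$ has size at most $f(|C|)$. A small set $A$ is an extension base for $\downarrow$ if $a\downarrow_A A$ for all tuples $a$. *)

(* Defs.v *)
From mathcomp Require Import all_boot.
From mathcomp Require Import boolp classical_sets functions cardinality.

Set Implicit Arguments.
Unset Strict Implicit.
Unset Printing Implicit Defensive.

Local Open Scope classical_set_scope.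
Local Open Scope card_scope.

Record language : Type := Language {
  fsym : Type;
  farity : fsym -> nat;
  rsym : Type;
  rarity : rsym -> nat }.

(* The (free) variables are taken in an arbitrary type V, so that
   "formula L (I + C)" is the type of formulas phi(x) with x an I-indexed
   tuple of variables and parameters named by C. *)
Inductive term (L : language) (V : Type) : Type :=
| TVar of V
| TApp (f : fsym L) of ('I_(farity f) -> term L V).

(* Under a quantifier, None is the bound variable. *)
Inductive formula (L : language) (V : Type) : Type :=
| FBot
| FEq of term L V & term L V
| FRel (r : rsym L) of ('I_(rarity r) -> term L V)
| FImp of formula L V & formula L V
| FAll of formula L (option V).

Definition FNot L V (phi : formula L V) : formula L V :=
  FImp phi (FBot L V).

Definition sentence (L : language) := formula L void.

Definition theory (L : language) := set (sentence L).

Record structure (L : language) : Type := Structure {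
  dom :> Type;
  dom_inhabited : inhabited dom;
  fint : forall f : fsym L, ('I_(farity f) -> dom) -> dom;
  rint : forall r : rsym L, ('I_(rarity r) -> dom) -> Prop }.

Fixpoint eval L (M : structure L) V (e : V -> M) (t : term L V) : M :=
  match t with
  | TVar v => e v
  | TApp f args => fint (fun i => eval e (args i))
  end.

Fixpoint sat L (M : structure L) V (e : V -> M) (phi : formula L V) : Prop :=
  match phi with
  | FBot => False
  | FEq t u => eval e t = eval e u
  | FRel r args => rint (fun i => eval e (args i))
  | FImp phi1 phi2 => sat e phi1 -> sat e phi2
  | FAll phi1 =>
      forall x : M, sat (fun v => if v is Some w then e w else x) phi1
  end.

Definition holds L (M : structure L) (phi : sentence L) : Prop :=
  sat (of_void M) phi.

Definition models L (M : structure L) (T : theory L) : Prop :=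
  forall phi, T phi -> holds M phi.

Definition Th L (M : structure L) : theory L := [set phi | holds M phi].

Definition entails L (T : theory L) (phi : sentence L) : Prop :=
  forall M : structure L, models M T -> holds M phi.

Definition complete_theory L (T : theory L) : Prop :=
  (exists M : structure L, models M T) /\
  forall phi : sentence L, entails T phi \/ entails T (FNot phi).

(* The variables of phi(x; y) are split as x (of length m), y (of length n). *)
Definition has_IP L (T : theory L) m n (phi : formula L ('I_m + 'I_n)) : Prop :=
  exists (M : structure L) (a : nat -> 'I_m -> M) (b : set nat -> 'I_n -> M),
    models M T /\
    forall (i : nat) (s : set nat),
      sat (fun v => match v with inl j => a i j | inr j => b s j end) phi
      <-> s i.

Definition NIP_theory L (T : theory L) : Prop :=
  forall m n (phi : formula L ('I_m + 'I_n)), ~ has_IP T phi.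

Definition NIP_structure L (M : structure L) : Prop := NIP_theory (Th M).

Definition unary_language (L : language) (P : Type) : language :=
  @Language (fsym L) (@farity L) (rsym L + P)%type
    (fun r => match r with inl r0 => rarity r0 | inr _ => 1 end).

Definition unary_expansion L (M : structure L) (P : Type) (U : P -> set M) :
    structure (unary_language L P) :=
  @Structure (unary_language L P) M (dom_inhabited M)
    (fun f => @fint L M f)
    (fun r => match r return
          ('I_(@rarity (unary_language L P) r) -> M) -> Prop with
       | inl r0 => @rint L M r0
       | inr p => fun x => U p (x ord0)
       end).

Definition monadically_NIP L (T : theory L) : Prop :=
  forall M : structure L, models M T ->
  forall (P : Type) (U : P -> set M), NIP_structure (unary_expansion U).

Definition tp L (M : structure L) (I : Type) (C : set M) (a : I -> M) :
    set (formula L (I + set_type C)) :=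
  [set phi | sat (fun v => match v with inl i => a i | inr d => set_val d end)
                 phi].
Arguments tp {L M I} C a.

Definition eqtp L (M : structure L) (I : Type) (C : set M) (a a' : I -> M) :
    Prop :=
  tp C a = tp C a'.
Arguments eqtp {L M I} C a a'.

Definition fin_sat L (M : structure L) (I : Type) (C : set M)
    (p : set (formula L (I + set_type C))) : Prop :=
  forall F, finite_set F -> F `<=` p -> exists a : I -> M, F `<=` tp C a.

Definition realizes L (M : structure L) (I : Type) (C : set M) (a : I -> M)
    (p : set (formula L (I + set_type C))) : Prop :=
  p `<=` tp C a.

Definition complete_type L (M : structure L) (I : Type) (C : set M)
    (p : set (formula L (I + set_type C))) : Prop :=
  fin_sat p /\ forall phi, p phi \/ p (FNot phi).

Definition automorphism L (M : structure L) (s : M -> M) : Prop :=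
  [/\ bijective s,
      forall (f : fsym L) (x : 'I_(farity f) -> M),
        s (fint x) = fint (fun i => s (x i))
    & forall (r : rsym L) (x : 'I_(rarity r) -> M),
        rint x <-> rint (fun i => s (x i))].

(* The saturation cardinal kappa is given by a type K of that cardinality. *)
Definition small (K : Type) (X : Type) (A : set X) : Prop :=
  (A #<= [set: K]) /\ ~ ([set: K] #<= A).

Definition strong_limit (K : Type) : Prop :=
  forall X : Type, small K [set: X] -> small K [set: set X].

Definition saturated (K : Type) L (M : structure L) : Prop :=
  forall (C : set M) (p : set (formula L (unit + set_type C))),
    small K C -> complete_type p -> exists a : unit -> M, realizes a p.

Definition strongly_homogeneous (K : Type) L (M : structure L) : Prop :=
  forall (I : Type) (a a' : I -> M),
    small K [set: I] -> eqtp set0 a a' ->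
    exists s : M -> M, automorphism s /\ forall i, s (a i) = a' i.

(* "formula L nat" has cardinality |L| + aleph_0; in particular kappa is
   uncountable. "Sufficiently saturated" is made precise by asking kappa to be
   a strong limit larger than |T|; kappa need not be regular. *)
Definition monster (K : Type) L (T : theory L) (M : structure L) : Prop :=
  [/\ models M T,
      small K [set: formula L nat],
      strong_limit K,
      saturated K M
    & strongly_homogeneous K M].

(* "ind a C b" stands for: a is independent from b over C. Only its values on
   small sets matter. A tuple c : I -> M is viewed as the set "range c". *)
Section Independence.
Variables (L : language) (M : structure L) (K : Type).
Variable ind : set M -> set M -> set M -> Prop.

Definition invariance : Prop :=
  forall (s : M -> M) (a C b : set M),
    small K a -> small K C -> small K b ->
    automorphism s -> ind a C b -> ind (s @` a) (s @` C) (s @` b).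

Definition monotonicity : Prop :=
  forall a a' C b b' : set M,
    small K a -> small K a' -> small K C -> small K b -> small K b' ->
    ind (a `|` a') C (b `|` b') -> ind a C b.

Definition strong_finite_character : Prop :=
  forall (I : Type) (a : I -> M) (C b : set M),
    small K [set: I] -> small K C -> small K b ->
    ~ ind (range a) C b ->
    exists2 phi : formula L (I + set_type (C `|` b)),
      tp (C `|` b) a phi
      & forall a' : I -> M, tp (C `|` b) a' phi -> ~ ind (range a') C b.

Definition base_monotonicity : Prop :=
  forall a C b c : set M,
    small K a -> small K C -> small K b -> small K c ->
    ind a C (b `|` c) -> ind a (C `|` b) c.

Definition left_transitivity : Prop :=
  forall a b C c : set M,
    small K a -> small K b -> small K C -> small K c ->
    ind a (C `|` b) c -> ind b C c -> ind (a `|` b) C c.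

Definition right_extension : Prop :=
  forall (a C b : set M) (I : Type) (c : I -> M),
    small K a -> small K C -> small K b -> small K [set: I] ->
    ind a C b ->
    exists2 c' : I -> M, eqtp (C `|` b) c' c & ind a C (b `|` range c').

Definition standard_preindependence : Prop :=
  [/\ invariance, monotonicity & strong_finite_character] /\
  [/\ base_monotonicity, left_transitivity & right_extension].

Definition left_extension_over (A : set M) : Prop :=
  forall (a b : set M) (I : Type) (c : I -> M),
    small K a -> small K b -> small K [set: I] ->
    ind a A b ->
    exists2 c' : I -> M, eqtp (A `|` a) c' c & ind (a `|` range c') A b.

Definition extension_base (A : set M) : Prop :=
  forall a : set M, small K a -> ind a A A.

(* A function on cardinals is a map f on types compatible with equipotence.
   It has to take small cardinals to small cardinals: the sets of types at
   hand all embed in powers of M, so a constant f with a value larger than M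
   would bound any relation. *)
Definition bounded : Prop :=
  exists f : Type -> Type,
    [/\ forall X Y : Type, [set: X] #= [set: Y] -> [set: f X] #= [set: f Y],
        forall X : Type, small K [set: X] -> small K [set: f X]
      & forall (C D : set M) (n : nat)
               (p : set (formula L ('I_n + set_type C))),
          small K C -> small K D -> C `<=` D -> complete_type p ->
          [set tp D a | a in [set a : 'I_n -> M |
                               realizes a p /\ ind (range a) C D]]
            #<= [set: f (set_type C)]].

Definition BS_trivial_over (A : set M) : Prop :=
  forall (a b : set M) (c : M),
    small K a -> small K b -> ind b A a ->
    ind (b `|` [set c]) A a \/ ind b A (a `|` [set c]).

End Independence.

(* Main.v *)
Require Import Defs.
From mathcomp Require Import all_boot.
From mathcomp Require Import boolp classical_sets functions cardinality filter.
From mathcomp Require Import zify.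

Set Implicit Arguments.
Unset Strict Implicit.
Unset Printing Implicit Defensive.

Local Open Scope classical_set_scope.
Local Open Scope card_scope.

(** Suppose that [b] is independent from [a] over [A] although neither [bc] is
independent from [a] nor [b] from [ac]. Strong finite character condenses the
two failures into one formula [theta(y, x, z)], true of [(b, a, c)], whose
instances at conjugates of [a] and of [ac] exclude both independences
([dependence_formula]); [b] may be taken finite. The plan is to let single
elements code pairs by means of [theta]: naming a set of coding elements by a
unary predicate then defines an arbitrary bipartite graph, against monadic
NIP.

Coding requires copies [(b_i, a_i)] of [(b, a)], each independent from the
earlier ones, such that [(b_s, a_t)] has the type of [(b, a)] whenever [t < s].
The last condition is where boundedness enters. Call two copies of [a] twins if
independent copies of [b] never tell them apart. A set of pairwise
non-twins embeds in the power set of a set of independent types over a common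
domain, so it is small ([non_twins_small]); as [A] is an extension base, [a] may
then be moved to be independent from a small set of representatives, hence from
one of its own twins ([independent_twin]). Copying [(b, a)] over that twin
yields the sequence ([independent_copies]).

Given [t < s], left extension frees some [c_ts] lying over [(b_s, a_t)] from the
copies before [t], and right extension frees the copies after [s] from it
([coding_element]). By the choice of [theta], the instance
[theta(b_u, a_v, c_ts)] holds at [(u, v) = (s, t)], and fails if [v < t < u] or
if [v = t] and [s < u] ([coding_configuration]). Ramsey's theorem makes all the
remaining instances depend only on the order of the indices, and then comparing
[a_v] and [b_u] with their neighbours in the sequence isolates the pair
[(s, t)] from all others ([coding_pattern]). Coding a bipartite graph that
contains every finite one shatters arbitrarily large finite sets, and an
ultrapower makes the shattered set infinite ([shattering_not_NIP]).

Types are handled through automorphisms: by homogeneity, two tuples have the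
same type over a small set if and only if an automorphism fixing that set
carries one to the other ([eqtp_fixing], [fixing_eqtp]). *)

(** * Small sets *)

Definition set_elem T (A : set T) (x : T) (Ax : A x) : set_type A :=
  exist _ x (mem_set Ax).

Lemma card_le_injective T U (A : set T) (B : set U) (f : T -> U) :
  (forall x, A x -> B (f x)) ->
  (forall x y, A x -> A y -> f x = f y -> x = y) -> A #<= B.
Proof.
move=> fAB finj.
have [g] : $|{injfun A >-> B}|.
  by apply/injfunPex; exists f => // x y /set_mem Ax /set_mem Ay; apply: finj.
exact: inj_card_le.
Qed.

Lemma card_le_fun T U (A : set T) (B : set U) : A #<= B ->
  exists2 f : set_type A -> U, injective f & forall x, B (f x).
Proof.
move=> /card_leP[f]; exists (fun x => set_val (f x)) => [x y /val_inj fxy|x].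
  by apply: (@inj _ _ _ f); rewrite ?inE.
exact: set_valP.
Qed.

Lemma cantor X (f : set X -> X) : ~ injective f.
Proof.
move=> finj; pose D := [set x | exists2 S, f S = x & ~ S x].
have DN : ~ D (f D) by move=> DfD; have [S /finj -> []] := DfD.
by apply: (DN); exists D; last exact: DN.
Qed.

(** Zorn's lemma for partial bijections: a maximal one is total on one of the
two sides. *)
Lemma card_le_comparable X Y : [set: X] #<= [set: Y] \/ [set: Y] #<= [set: X].
Proof.
pose pinj (G : set (X * Y)) :=
  forall p q, G p -> G q -> p.1 = q.1 <-> p.2 = q.2.
have [|G [Ginj Gmax]] := @Zorn_bigcup _ pinj.
  move=> F Finj Ftot p q [G1 FG1 G1p] [G2 FG2 G2q].
  have [G12|G21] := Ftot _ _ FG1 FG2.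
    by apply: (Finj _ FG2) => //; apply: G12.
  by apply: (Finj _ FG1) => //; apply: G21.
have [domG|/existsNP[x xG]] := pselect (forall x, exists y, G (x, y)).
  have [f fG] := choice domG; left.
  apply: (@card_le_injective _ _ _ _ f) => // x y _ _ fxy.
  by have [_ /(_ fxy)] := Ginj _ _ (fG x) (fG y).
have [codG|/existsNP[y yG]] := pselect (forall y, exists x, G (x, y)).
  have [f fG] := choice codG; right.
  apply: (@card_le_injective _ _ _ _ f) => // u v _ _ fuv.
  by have [/(_ fuv)] := Ginj _ _ (fG u) (fG v).
exfalso; apply: (Gmax (G `|` [set (x, y)])).
  split=> [p Gp|sub]; first by left.
  by apply: xG; exists y; apply: sub; right.
move=> [u v] [u' v'] [Guv|[-> ->]] [Guv'|[-> ->]] //=.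
- exact: (Ginj _ _ Guv Guv').
- by split=> E; subst; [case: xG; exists v|case: yG; exists u].
- by split=> E; subst; [case: xG; exists v'|case: yG; exists u'].
Qed.

Lemma card_le_total T U (A : set T) (B : set U) : A #<= B \/ B #<= A.
Proof.
have [AB|BA] := card_le_comparable (set_type A) (set_type B); [left|right].
- apply: card_le_trans (_ : [set: set_type A] #<= _).
    by have := card_setT A; rewrite card_eq_le => /andP[].
  apply: card_le_trans AB _; by have := card_setT B; rewrite card_eq_le => /andP[].
- apply: card_le_trans (_ : [set: set_type B] #<= _).
    by have := card_setT B; rewrite card_eq_le => /andP[].
  apply: card_le_trans BA _; by have := card_setT A; rewrite card_eq_le => /andP[].
Qed.

Section Small.
Variable K : Type.
Hypothesis K_strong_limit : strong_limit K.
Hypothesis K_nat : small K [set: nat].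

Lemma small_le T U (A : set T) (B : set U) : A #<= B -> small K B -> small K A.
Proof.
move=> AB [BK KB]; split; first exact: card_le_trans BK.
by move=> KA; apply: KB; apply: card_le_trans AB.
Qed.

Lemma small_sub T (A B : set T) : A `<=` B -> small K B -> small K A.
Proof. by move=> /subset_card_le; apply: small_le. Qed.

Lemma small_image T U (f : T -> U) (A : set T) : small K A -> small K (f @` A).
Proof. exact/small_le/card_image_le. Qed.

Lemma small_range T U (f : T -> U) : small K [set: T] -> small K (range f).
Proof. exact: small_image. Qed.

Lemma small_type T (A : set T) : small K A -> small K [set: set_type A].
Proof.
by apply: small_le; have := card_setT A; rewrite card_eq_le => /andP[].
Qed.

Lemma small_finite T (A : set T) : finite_set A -> small K A.
Proof. by move=> /finite_set_countable /small_le; apply. Qed.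

(** Kuratowski pairs embed the square of the larger set into its double power
set, which is small because the bound is a strong limit. *)
Lemma small_prod X Y :
  small K [set: X] -> small K [set: Y] -> small K [set: X * Y].
Proof.
move=> sX sY.
have sq Z : small K [set: Z] -> small K [set: Z * Z].
  move=> /K_strong_limit/K_strong_limit; apply: small_le.
  apply: (@card_le_injective _ _ _ _
    (fun p : Z * Z => [set [set p.1]; [set p.1; p.2]])) => //.
  move=> [x y] [x' y'] _ _ /= E.
  have Ex : x = x'.
    have : [set [set x]; [set x; y]] [set x'] by rewrite E; left.
    by case=> /seteqP[_ H]; [have := H x (erefl _)|have := H x (or_introl (erefl _))].
  subst x'; congr pair.
  have : [set [set x]; [set x; y']] [set x; y] by rewrite -E; right.
  have : [set [set x]; [set x; y]] [set x; y'] by rewrite E; right.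
  by case=> [E1|E1] [E2|E2];
    move/seteqP: E1 => [H1 H1']; move/seteqP: E2 => [H2 H2'];
    have /= := H1 y' (or_intror (erefl _)); have /= := H2 y (or_intror (erefl _));
    have /= := H1' y; have /= := H2' y'; intuition congruence.
have [XY|YX] := card_le_comparable X Y.
  have [f finj _] := card_le_fun XY.
  apply: small_le (sq _ sY).
  apply: (@card_le_injective _ _ _ _
    (fun p : X * Y => (f (exist _ p.1 (mem_set I)), p.2))) => //.
  by move=> [x y] [x' y'] _ _ /= [/finj[-> ->]].
have [f finj _] := card_le_fun YX.
apply: small_le (sq _ sX).
apply: (@card_le_injective _ _ _ _
  (fun p : X * Y => (p.1, f (exist _ p.2 (mem_set I))))) => //.
by move=> [x y] [x' y'] _ _ /= [-> /finj[->]].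
Qed.

Lemma small_setU T (A B : set T) :
  small K A -> small K B -> small K (A `|` B).
Proof.
move=> sA sB.
have [->|/set0P[a Aa]] := eqVneq A set0; first by rewrite set0U.
have [->|/set0P[b Bb]] := eqVneq B set0; first by rewrite setU0.
pose f (p : bool * (set_type A * set_type B)) :=
  if p.1 then set_val p.2.1 else set_val p.2.2.
apply: (@small_sub _ _ (range f)).
  move=> x [Ax|Bx].
    by exists (true, (exist _ x (mem_set Ax), exist _ b (mem_set Bb))).
  by exists (false, (exist _ a (mem_set Aa), exist _ x (mem_set Bx))).
apply/small_range/small_prod; last by apply: small_prod; apply: small_type.
exact/small_finite/finite_finset.
Qed.

Lemma small_set1 T (x : T) : small K [set x].
Proof. exact/small_finite/finite_set1. Qed.

Lemma small_setU1 T (A : set T) (x : T) : small K A -> small K (A `|` [set x]).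
Proof. by move=> sA; apply: small_setU; last exact: small_set1. Qed.

Lemma small_sum X Y :
  small K [set: X] -> small K [set: Y] -> small K [set: X + Y].
Proof.
move=> sX sY; apply: (@small_sub _ _ (range inl `|` range inr)).
  by move=> [x|y] _; [left; exists x|right; exists y].
by apply: small_setU; apply: small_range.
Qed.

End Small.

(** * Ramsey's theorem and the coding pattern *)

Definition increasing (h : nat -> nat) := {homo h : i j / i < j}.

Definition homogeneous k (P : seq nat -> Prop) (h : nat -> nat) :=
  forall l l', sorted ltn l -> sorted ltn l' -> size l = k -> size l' = k ->
    P (map h l) <-> P (map h l').

Lemma increasing_comp h h' : increasing h -> increasing h' -> increasing (h \o h').
Proof. by move=> hinc h'inc i j ij; apply/hinc/h'inc. Qed.

Lemma increasing_sorted h l :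
  increasing h -> sorted ltn l -> sorted ltn (map h l).
Proof. by move=> hinc; apply: homo_sorted => i j; apply: hinc. Qed.

Lemma homogeneous_comp k P h f :
  increasing f -> homogeneous k P h -> homogeneous k P (h \o f).
Proof.
move=> finc Ph l l' sl sl' zl zl'; rewrite !(map_comp h f).
by apply: Ph; rewrite ?size_map //; apply: increasing_sorted.
Qed.

Lemma increasingS h : (forall i, h i < h i.+1) -> increasing h.
Proof. by move=> hS; apply: homo_ltn => // ? ? ?; apply: ltn_trans. Qed.

Lemma infinite_increasing (P : nat -> Prop) :
  (forall n, exists2 m, n <= m & P m) ->
  exists2 f, increasing f & forall i, P (f i).
Proof.
move=> Pinf; have /choice[g gP] n : exists m, n <= m /\ P m.
  by have [m nm Pm] := Pinf n; exists m.
pose f := fix f n := if n is n'.+1 then g (f n').+1 else g 0.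
exists f; last by case=> [|n]; apply: (gP _).2.
by apply: increasingS => i /=; apply: (gP _).1.
Qed.

Lemma prop_pigeonhole (P : nat -> Prop) :
  exists2 f, increasing f & forall i j, P (f i) <-> P (f j).
Proof.
have [|/existsNP[n Pn]] := pselect (forall n, exists2 m, n <= m & P m).
  by move=> /infinite_increasing[f finc Pf]; exists f => // i j; split.
exists (addn n) => [i j|i j]; first by rewrite ltn_add2l.
by split=> Pni; exfalso; apply: Pn; [exists (n + i)|exists (n + j)];
  rewrite ?leq_addr.
Qed.

(** Induction on [k]. Repeatedly, the first remaining index is set aside and the
others are thinned out so that [P] no longer depends on how the tuples starting
with it continue; the resulting two-colouring of the indices set aside is then
constant on an infinite subset. *)
Lemma ramsey k P : exists2 h, increasing h & homogeneous k P h.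
Proof.
elim: k P => [|k IH] P.
  by exists id => // l l' _ _ /size0nil -> /size0nil ->.
have step (g : nat -> nat) : exists h, increasing h /\
    homogeneous k (fun l => P (g 0 :: map g (map succn l))) h.
  by have [h hinc hom] := IH (fun l => P (g 0 :: map g (map succn l))); exists h.
have [H /all_and2[Hinc Hhom]] := choice step.
pose G := fix G n := if n is n'.+1 then G n' \o succn \o H (G n') else id.
have Ginc n : increasing (G n).
  elim: n => // n IHn; apply: increasing_comp (Hinc _).
  by apply: increasing_comp.
(* [G n] enumerates the indices that remain after [n] rounds. *)
pose x n := G n 0.
have Gsub i j : i <= j -> exists2 g, increasing g & G j = G i \o g.
  elim: j => [|j IHj]; first by rewrite leqn0 => /eqP ->; exists id.
  rewrite leq_eqVlt => /predU1P[->|]; first by exists id.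
  rewrite ltnS => /IHj[g ginc Gg]; exists (g \o succn \o H (G j)).
    by apply: increasing_comp (Hinc _); apply: increasing_comp.
  by rewrite /= Gg.
have xinc : increasing x.
  apply: increasingS => i; rewrite /x /=; apply: Ginc.
  exact: leq_trans (ltn0Sn _).
have tail i l : path ltn i l -> exists2 l', sorted ltn l' &
    map x l = map (G i.+1) l'.
  case: l => [|j l]; first by exists [::].
  move=> /= /andP[ij jl].
  have /choice[y yP] : forall m, exists n, i < m -> x m = G i.+1 n.
    move=> m; have [im|mi] := ltnP i m; last by exists 0.
    by have [g _ Gg] := Gsub _ _ im; exists (g 0); rewrite /x Gg.
  have all_i : all (ltn i) (j :: l).
    rewrite /= ij; apply: sub_all (order_path_min ltn_trans jl) => m.
    exact: ltn_trans.
  exists (map y (j :: l)); last first.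
    rewrite -(map_comp (G i.+1) y) -[LHS]/(map x (j :: l)); apply/eq_in_map => m /(allP all_i) im /=.
    exact: yP.
  have yinc : {in ltn i &, {homo y : m n / m < n}}.
    move=> m n im in_ mn; have := xinc _ _ mn; rewrite (yP _ im) (yP _ in_).
    by apply: contraTT; rewrite -!leqNgt leq_eqVlt => /predU1P[->//|/Ginc/ltnW].
  by apply: (homo_sorted_in yinc all_i); rewrite /= jl.
have const i l l' : path ltn i l -> path ltn i l' -> size l = k ->
    size l' = k -> P (map x (i :: l)) <-> P (map x (i :: l')).
  move=> il il' zl zl' /=.
  have [m sm Em] := tail _ _ il; have [m' sm' Em'] := tail _ _ il'.
  have GE z : map (G i) (map succn (map (H (G i)) z)) = map (G i.+1) z.
    by rewrite -!map_comp.
  have := Hhom (G i) m m' sm sm'; rewrite /= !GE -Em -Em'; apply.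
    by rewrite -zl -(size_map x l) Em size_map.
  by rewrite -zl' -(size_map x l') Em' size_map.
pose K i := forall l, path ltn i l -> size l = k -> P (map x (i :: l)).
have KP i l : path ltn i l -> size l = k -> P (map x (i :: l)) <-> K i.
  move=> il zl; split=> [Pil l' il' zl'|]; last exact.
  exact/(const _ l).
have [f finc fK] := prop_pigeonhole K.
exists (x \o f); first exact: increasing_comp.
move=> [|i l] [|i' l'] //= sl sl' [zl] [zl'].
have shift j m : path ltn j m -> path ltn (f j) (map f m).
  by rewrite path_map; apply: sub_path => u v; apply: finc.
rewrite !(map_comp x f) -!map_cons.
by rewrite !KP ?size_map //; apply: shift.
Qed.

Lemma ramsey_seq k (Ps : seq (seq nat -> Prop)) :
  exists2 h, increasing h & forall P, List.In P Ps -> homogeneous k P h.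
Proof.
elim: Ps => [|P Ps [h hinc hom]]; first by exists id.
have [f finc Phom] := ramsey k (P \o map h).
exists (h \o f); first exact: increasing_comp.
move=> Q /= [<-|Qin]; last exact: homogeneous_comp finc (hom Q Qin).
by move=> l l' sl sl' zl zl'; have := Phom l l' sl sl' zl zl'; rewrite /= -!(map_comp h f).
Qed.

(** Here [Theta u v t s] stands for [theta(b_u, a_v, c_ts)]. On a homogeneous
subsequence its truth value depends only on the order of the indices, so that
it cannot change when [v] moves to a neighbouring index [v'], except if one of
the two is [t]. Hence the combination [Theta u v t s] and not [Theta u v' t s],
with [v'] the predecessor of [v], forces [v = t]; likewise, once [v = t],
comparing [u] with its successor forces [u = s]. *)
Lemma coding_pattern (Theta : nat -> nat -> nat -> nat -> Prop) :
  (forall t s, t < s -> Theta s t t s) ->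
  (forall v t s u, v < t -> t < s -> t < u -> ~ Theta u v t s) ->
  (forall t s u, t < s -> s < u -> ~ Theta u t t s) ->
  exists x x' y y' : nat -> nat, forall E : nat -> nat -> Prop,
  exists Z : nat -> nat -> Prop,
    forall i j, i < j -> E i j <-> exists t s, [/\ Z t s, Theta (y j) (x i) t s,
      ~ Theta (y j) (x' i) t s & ~ Theta (y' j) (x i) t s].
Proof.
move=> Tdiag Tleft Tright.
pose pat a b c d (l : seq nat) :=
  Theta (nth 0 l a) (nth 0 l b) (nth 0 l c) (nth 0 l d).
(* The six patterns are the relative orders of [u, v, t, s] within which two
values of [Theta] are compared; if only three of the indices are distinct, the
fourth entry is padding. *)
have [h hinc hom] := ramsey_seq 4 [:: pat 1 0 2 3; pat 3 2 0 1; pat 3 1 0 2;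
  pat 2 1 0 3; pat 2 1 0 2; pat 1 0 0 2].
have hmono i j : (h i < h j) = (i < j).
  by apply/idP/idP; [apply: contraTT; rewrite -!leqNgt leq_eqVlt
    => /predU1P[->//|/hinc/ltnW]|exact: hinc].
pose Th u v t s := Theta (h u) (h v) (h t) (h s).
have use P w0 w1 w2 w3 w0' w1' w2' w3' : List.In P
    [:: pat 1 0 2 3; pat 3 2 0 1; pat 3 1 0 2; pat 2 1 0 3; pat 2 1 0 2; pat 1 0 0 2] ->
    w0 < w1 < w2 /\ w2 < w3 -> w0' < w1' < w2' /\ w2' < w3' ->
    P (map h [:: w0; w1; w2; w3]) <-> P (map h [:: w0'; w1'; w2'; w3']).
  move=> Pin [/andP[w01 w12] w23] [/andP[w01' w12'] w23']; have homP := hom P Pin.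
  by apply: homP; rewrite //= ?w01 ?w12 ?w23 ?w01' ?w12' ?w23'.
have uts v v' u t s : v < u -> v' < u -> u < t -> t < s ->
    Th u v t s <-> Th u v' t s.
  by move=> *; apply: (use _ v u t s v' u t s (or_introl (erefl _))); lia.
have tsv v v' u t s : s < v < u -> s < v' < u -> t < s ->
    Th u v t s <-> Th u v' t s.
  move=> *; apply: (use (pat 3 2 0 1) t s v u t s v' u); [|lia|lia].
  by rewrite /=; tauto.
have tvsu v v' u t s : t < v < s -> t < v' < s -> s < u ->
    Th u v t s <-> Th u v' t s.
  move=> *; apply: (use (pat 3 1 0 2) t v s u t v' s u); [|lia|lia].
  by rewrite /=; tauto.
have tvus v v' u t s : t < v < u -> t < v' < u -> u < s ->
    Th u v t s <-> Th u v' t s.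
  move=> *; apply: (use (pat 2 1 0 3) t v u s t v' u s); [|lia|lia].
  by rewrite /=; tauto.
have tvs v v' t s : t < v < s -> t < v' < s -> Th s v t s <-> Th s v' t s.
  move=> *; apply: (use (pat 2 1 0 2) t v s s.+1 t v' s s.+1); [|lia|lia].
  by rewrite /=; tauto.
have tus t u u' s : t < u < s -> t < u' < s -> Th u t t s <-> Th u' t t s.
  move=> *; apply: (use (pat 1 0 0 2) t u s s.+1 t u' s s.+1); [|lia|lia].
  by rewrite /=; tauto.
(* Left indices are [1] and right indices [2] modulo [4], so that passing to the
neighbour, [4 * i] or [4 * j + 3], crosses none of the indices in use. *)
exists (fun i => h (4 * i + 1)), (fun i => h (4 * i)),
  (fun j => h (4 * j + 2)), (fun j => h (4 * j + 3)) => E.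
exists (fun t s => exists i j,
  [/\ i < j, E i j, t = h (4 * i + 1) & s = h (4 * j + 2)]).
move=> i j ij; split=> [Eij|].
  exists (h (4 * i + 1)), (h (4 * j + 2)); split; first by exists i, j.
  - by apply: Tdiag; rewrite hmono; lia.
  - by apply: Tleft; rewrite hmono; lia.
  - by apply: Tright; rewrite hmono; lia.
move=> [_ [_ [[i' [j' [ij' Eij' -> ->]]]]]].
rewrite -!/(Th _ _ _ _) => Tyx NTyx' NTy'x.
have [lti|gti|eqi] := ltngtP i i'.
- have [ltj|gej] := ltnP j i'.
    by case: NTyx'; apply: (uts _ _ _ _ _ _ _ _ _).1 Tyx; lia.
  by exfalso; apply: Tleft Tyx; rewrite hmono; lia.
- case: NTyx'; have [ltj|gtj|eqj] := ltngtP j j'.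
  + by apply: (tvus _ _ _ _ _ _ _ _).1 Tyx; lia.
  + have [s_lt|v_lt] := ltnP j' i.
      by apply: (tsv _ _ _ _ _ _ _ _).1 Tyx; lia.
    by apply: (tvsu _ _ _ _ _ _ _ _).1 Tyx; lia.
  + by subst j'; apply: (tvs _ _ _ _ _ _).1 Tyx; lia.
- subst i'; have [ltj|gtj|eqj] := ltngtP j j'; last by subst j'.
    by case: NTy'x; apply: (tus _ _ _ _ _ _).1 Tyx; lia.
  by exfalso; apply: Tright Tyx; rewrite hmono; lia.
Qed.

(** The graph joining [i] to [j] when the [i]-th binary digit of [j] is one
contains every finite bipartite graph. *)
Lemma binary_digits (S : nat -> Prop) n :
  exists2 j, n <= j & forall i, i < n -> odd (j %/ 2 ^ i) <-> S i.
Proof.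
have digitD k m i j : i < k -> odd ((m * 2 ^ k + j) %/ 2 ^ i) = odd (j %/ 2 ^ i).
  move=> ik; rewrite -(subnK (ltnW ik)) expnD mulnA divnMDl ?expn_gt0 //.
  by rewrite oddD oddM oddX subn_eq0 leqNgt ik andbF.
suff [j jn Sj] : exists2 j, j < 2 ^ n & forall i, i < n -> odd (j %/ 2 ^ i) <-> S i.
  exists (1 * 2 ^ n + j); first by have := ltn_expl n (ltnSn 1); lia.
  by move=> i i_n; rewrite digitD // Sj.
elim: n => [|n [j jn Sj]]; first by exists 0.
exists (`[< S n >] * 2 ^ n + j).
  by rewrite expnS; case: `[< _ >]; lia.
move=> i; rewrite ltnS leq_eqVlt => /predU1P[->|i_n]; last by rewrite digitD // Sj.
rewrite divnMDl ?expn_gt0 // divn_small // addn0.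
by case: asboolP.
Qed.

(** * Variables of a formula *)

Fixpoint term_vars L (V : Type) (t : term L V) : set V :=
  match t with
  | TVar v => [set v]
  | TApp f args => \bigcup_i term_vars (args i)
  end.

Fixpoint free_vars L (V : Type) (phi : formula L V) : set V :=
  match phi with
  | FBot => set0
  | FEq t u => term_vars t `|` term_vars u
  | FRel r args => \bigcup_i term_vars (args i)
  | FImp phi1 phi2 => free_vars phi1 `|` free_vars phi2
  | FAll phi1 => Some @^-1` free_vars phi1
  end.

Lemma term_vars_finite L V (t : term L V) : finite_set (term_vars t).
Proof.
elim: t => [v|f args IH] /=; first exact: finite_set1.
by apply: bigcup_finite => // ; apply: finite_finset.
Qed.

Lemma free_vars_finite L V (phi : formula L V) : finite_set (free_vars phi).
Proof.
elim: phi => {V} [V|V t u|V r args|V phi1 IH1 phi2 IH2|V phi1 IH1] /=.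
- exact: finite_set0.
- by rewrite finite_setU; split; apply: term_vars_finite.
- apply: bigcup_finite; first exact: finite_finset.
  by move=> i _; apply: term_vars_finite.
- by rewrite finite_setU.
- apply: card_le_finite IH1.
  by apply: (@card_le_injective _ _ _ _ Some) => // x y _ _ [].
Qed.

Lemma eval_agree L (M : structure L) V (t : term L V) (e e' : V -> M) :
  (forall v, term_vars t v -> e v = e' v) -> eval e t = eval e' t.
Proof.
elim: t => [v|f args IH] /= ee'; first exact: ee'.
by congr fint; apply: funext => i; apply: IH => v tv; apply: ee'; exists i.
Qed.

Lemma sat_agree L (M : structure L) V (phi : formula L V) (e e' : V -> M) :
  (forall v, free_vars phi v -> e v = e' v) -> sat e phi <-> sat e' phi.
Proof.
elim: phi e e' => {V} [V|V t u|V r args|V phi1 IH1 phi2 IH2|V phi1 IH1] e e' ee' //=.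
- by rewrite !(@eval_agree _ _ _ _ e e') // => v tv; apply: ee'; [right|left].
- suff -> : (fun i => eval e (args i)) = (fun i => eval e' (args i)) by [].
  by apply: funext => i; apply: eval_agree => v tv; apply: ee'; exists i.
- have [H1 H1'] := IH1 e e' (fun v pv => ee' v (or_introl pv)).
  by have [H2 H2'] := IH2 e e' (fun v pv => ee' v (or_intror pv)); split; auto.
- have H x : sat (fun v => if v is Some w then e w else x) phi1 <->
             sat (fun v => if v is Some w then e' w else x) phi1.
    by apply: IH1 => -[v|] //= pv; apply: ee'.
  by split=> He x; apply/H.
Qed.

Lemma sat_eq L (M : structure L) V (phi : formula L V) (e e' : V -> M) :
  e =1 e' -> sat e phi <-> sat e' phi.
Proof. by move=> ee'; apply: sat_agree => v _; apply: ee'. Qed.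

Fixpoint rename_term L (V W : Type) (h : V -> W) (t : term L V) : term L W :=
  match t with
  | TVar v => TVar L (h v)
  | TApp f args => TApp (fun i => rename_term h (args i))
  end.

Fixpoint rename L (V W : Type) (h : V -> W) (phi : formula L V) : formula L W :=
  match phi with
  | FBot => FBot L W
  | FEq t u => FEq (rename_term h t) (rename_term h u)
  | FRel r args => FRel (fun i => rename_term h (args i))
  | FImp phi1 phi2 => FImp (rename h phi1) (rename h phi2)
  | FAll phi1 => FAll (rename (omap h) phi1)
  end.

Lemma eval_rename L (M : structure L) V W (h : V -> W) (t : term L V) (e : W -> M) :
  eval e (rename_term h t) = eval (e \o h) t.
Proof. by elim: t => //= f args IH; congr fint; apply: funext. Qed.

Lemma sat_rename L (M : structure L) V W (h : V -> W) (phi : formula L V)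
    (e : W -> M) :
  sat e (rename h phi) <-> sat (e \o h) phi.
Proof.
elim: phi W h e => {V} [V|V t u|V r args|V phi1 IH1 phi2 IH2|V phi1 IH1] W h e //=.
- by rewrite !eval_rename.
- suff -> : (fun i => eval e (rename_term h (args i))) =
            (fun i => eval (e \o h) (args i)) by [].
  by apply: funext => i; rewrite eval_rename.
- by rewrite IH1 IH2.
- have H x : sat (fun v => if v is Some w then e w else x) (rename (omap h) phi1)
      <-> sat (fun v => if v is Some w then (e \o h) w else x) phi1.
    by rewrite IH1; apply: sat_eq => -[v|].
  by split=> He x; apply/H.
Qed.

(** This replaces the finitely many variables of a formula by an ordinal. The
ordinal is a successor, and [h] is total, so that [h] can rename a formula whose
variables range over all of [V], even over an empty [V]. *)
Lemma finite_factor V (F : set V) : finite_set F ->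
  exists n (h : V -> 'I_n.+1), forall X (x0 : X) (e : V -> X),
    exists e' : 'I_n.+1 -> X, forall v, F v -> e' (h v) = e v.
Proof.
move=> [n Fn].
have Fle : F #<= `I_n by move: Fn; rewrite card_eq_le => /andP[].
have [f] := elimT card_leP Fle.
pose h v : 'I_n.+1 :=
  if pselect (F v) is left Fv then inord (set_val (f (exist _ v (mem_set Fv)))) else ord0.
have hinj v w : F v -> F w -> h v = h w -> v = w.
  rewrite /h; case: pselect => // Fv _; case: pselect => // Fw _ /(congr1 (@nat_of_ord _)).
  have lt (z : set_type `I_n) : set_val z < n.+1.
    by apply: ltnW; have := set_valP z.
  rewrite !inordK // => /val_inj fvw.
  have /(congr1 set_val) // : exist _ v (mem_set Fv) = exist _ w (mem_set Fw) :> set_type F.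
  by apply: (@inj _ _ _ f); rewrite ?inE.
exists n, h => X x0 e.
have /choice[e' e'P] (i : 'I_n.+1) :
    exists x, forall v, F v -> h v = i -> x = e v.
  have [[v [Fv hv]]|no] := pselect (exists v, F v /\ h v = i).
    by exists (e v) => w Fw hw; congr e; apply: hinj; rewrite // hv hw.
  by exists x0 => v Fv hv; case: no; exists v.
by exists e' => v Fv; apply: e'P.
Qed.

Definition FAnd L V (phi psi : formula L V) : formula L V :=
  FNot (FImp phi (FNot psi)).

Definition FEx L V (phi : formula L (option V)) : formula L V :=
  FNot (FAll (FNot phi)).

Lemma sat_not L (M : structure L) V (e : V -> M) (phi : formula L V) :
  sat e (FNot phi) <-> ~ sat e phi.
Proof. by []. Qed.

Lemma sat_and L (M : structure L) V (e : V -> M) (phi psi : formula L V) :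
  sat e (FAnd phi psi) <-> sat e phi /\ sat e psi.
Proof.
split=> [H|[H1 H2] /= H]; last exact: H.
by split; apply: contrapT => N; apply: H => /= *; apply: N.
Qed.

Lemma sat_ex L (M : structure L) V (e : V -> M) (phi : formula L (option V)) :
  sat e (FEx phi) <->
  exists x : M, sat (fun v => if v is Some w then e w else x) phi.
Proof.
split=> [H|[x Hx] /= H]; last exact: (H x).
by apply: contrapT => N; apply: H => /= x Hx; apply: N; exists x.
Qed.

Fixpoint lift_term L (P V : Type) (t : term L V) : term (unary_language L P) V :=
  match t with
  | TVar v => TVar _ v
  | TApp f args =>
      @TApp (unary_language L P) V f (fun i => lift_term P (args i))
  end.

Fixpoint lift_formula L (P V : Type) (phi : formula L V) : formula (unary_language L P) V :=
  match phi with
  | FBot => FBot _ _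
  | FEq t u => FEq (lift_term P t) (lift_term P u)
  | FRel r args =>
      @FRel (unary_language L P) V (inl r) (fun i => lift_term P (args i))
  | FImp phi1 phi2 => FImp (lift_formula P phi1) (lift_formula P phi2)
  | FAll phi1 => FAll (lift_formula P phi1)
  end.

Lemma sat_lift L (M : structure L) P (U : P -> set M) V (phi : formula L V)
    (e : V -> M) :
  @sat _ (unary_expansion U) V e (lift_formula P phi) <-> sat e phi.
Proof.
have eval_lift W (e' : W -> M) (t : term L W) :
    @eval _ (unary_expansion U) W e' (lift_term P t) = eval e' t.
  by elim: t => //= f args IH; congr fint; apply: funext.
elim: phi e => {V} [V|V t u|V r args|V phi1 IH1 phi2 IH2|V phi1 IH1] e //=.
- by rewrite !eval_lift.
- suff -> : (fun i => @eval _ (unary_expansion U) _ e (lift_term P (args i))) =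
            (fun i => eval e (args i)) by [].
  by apply: funext => i; rewrite eval_lift.
- by rewrite IH1 IH2.
- by split=> H x; apply/IH1.
Qed.

(** * Automorphisms *)

Lemma automorphism_eval L (M : structure L) (s : M -> M) V (e : V -> M) t :
  automorphism s -> eval (s \o e) t = s (eval e t).
Proof.
case=> _ sf _; elim: t => //= f args IH.
by rewrite sf; congr fint; apply: funext.
Qed.

Lemma automorphism_sat L (M : structure L) (s : M -> M) V (e : V -> M) phi :
  automorphism s -> sat (s \o e) phi <-> sat e phi.
Proof.
move=> sA; have [sbij _ sr] := sA.
elim: phi e => {V} [V|V t u|V r args|V phi1 IH1 phi2 IH2|V phi1 IH1] e //=.
- by rewrite !automorphism_eval //; split=> [/(bij_inj sbij)|->].
- rewrite (sr r (fun i => eval e (args i))); suff -> : (fun i => eval (s \o e) (args i)) =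
                            (fun i => s (eval e (args i))) by [].
  by apply: funext => i; rewrite automorphism_eval.
- by rewrite IH1 IH2.
- have [s' sK s'K] := sbij.
  have H x : sat (fun v => if v is Some w then (s \o e) w else s x) phi1 <->
             sat (fun v => if v is Some w then e w else x) phi1.
    by rewrite -(IH1 (fun v => if v is Some w then e w else x));
      apply: sat_eq => -[v|].
  split=> He x; first exact/H.
  by rewrite -[x]s'K; apply/H.
Qed.

Lemma automorphism_inv L (M : structure L) (s : M -> M) : automorphism s ->
  exists s', [/\ automorphism s', cancel s s' & cancel s' s].
Proof.
move=> [sbij sf sr]; have [s' sK s'K] := sbij.
exists s'; split=> //; split; first by exists s.
- move=> f x; apply: (bij_inj sbij); rewrite s'K sf; congr fint.
  by apply: funext => i; rewrite s'K.
- move=> r x; rewrite (sr r (fun i => s' (x i))).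
  suff -> : (fun i => s (s' (x i))) = x by [].
  by apply: funext => i; rewrite s'K.
Qed.

Lemma automorphism_comp L (M : structure L) (s s' : M -> M) :
  automorphism s -> automorphism s' -> automorphism (s \o s').
Proof.
move=> [sbij sf sr] [s'bij s'f s'r]; split; first exact: bij_comp.
  by move=> f x /=; rewrite s'f sf.
by move=> r x /=; rewrite s'r sr.
Qed.

Lemma automorphism_id L (M : structure L) : automorphism (@id M).
Proof. by split=> //; exists id. Qed.

(** * Ultrapowers and the independence property *)

Section Ultrapower.
Variables (L : language) (M : structure L) (U : set_system nat).
Hypothesis UU : UltraFilter U.

(** An element of the ultrapower is an actual equivalence class, because the
equality symbol is interpreted by equality. *)
Definition ultra_class (x : nat -> M) : set (nat -> M) :=
  [set y | U [set n | x n = y n]].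

Definition ultra_dom : Type := {C : set (nat -> M) | exists x, C = ultra_class x}.

Definition ultra_mk (x : nat -> M) : ultra_dom :=
  exist _ (ultra_class x) (ex_intro _ x (erefl _)).

Definition ultra_repr (C : ultra_dom) : nat -> M := sval (cid (svalP C)).

Lemma ultra_reprK C : ultra_mk (ultra_repr C) = C.
Proof.
case: C => C ex; apply: eq_exist => /=; rewrite /ultra_repr /=.
by case: cid.
Qed.

Lemma ultra_mk_eq x y : ultra_mk x = ultra_mk y <-> U [set n | x n = y n].
Proof.
split=> [[E]|Uxy].
  suff : ultra_class x y by [].
  by rewrite E; apply: filterS filterT => n _ /=.
apply: eq_exist; apply/seteqP; split=> z /= Uz.
  by apply: filterS2 Uxy Uz => n /= <-.
by apply: filterS2 Uxy Uz => n /= ->.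
Qed.

Lemma ultra_repr_mk x : U [set n | ultra_repr (ultra_mk x) n = x n].
Proof. by apply/ultra_mk_eq; rewrite ultra_reprK. Qed.

Definition ultrapower : structure L :=
  @Structure L ultra_dom
    (let: inhabits x := dom_inhabited M in inhabits (ultra_mk (fun=> x)))
    (fun f args => ultra_mk (fun n => fint (fun i => ultra_repr (args i) n)))
    (fun r args => U [set n | rint (fun i => ultra_repr (args i) n)]).

Definition ultra_env V (e : V -> ultrapower) n : V -> M :=
  fun v => ultra_repr (e v) n.

Lemma ultra_eval V (e : V -> ultrapower) (t : term L V) :
  U [set n | ultra_repr (eval e t) n = eval (ultra_env e n) t].
Proof.
elim: t => [v|f args IH] /=; first by apply: filterS filterT.
have /filterS2 := ultra_repr_mk
  (fun n => fint (fun i => ultra_repr (eval e (args i)) n)).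
apply; last exact: filter_forall IH.
by move=> n /= -> H; congr fint; apply: funext.
Qed.

Lemma ultra_meet (P Q : set nat) : U P -> U Q -> exists n, P n /\ Q n.
Proof.
move=> UP UQ; have UPQ : U (P `&` Q) by apply: filterI.
by have [n [Pn Qn]] := filter_ex UPQ; exists n.
Qed.

Lemma ultra_not (P : set nat) : U (~` P) <-> ~ U P.
Proof.
split=> [UnP UP|]; last by case: (in_ultra_setVsetC P UU).
by have [n []] := ultra_meet UP UnP.
Qed.

Lemma ultra_iff (P Q : set nat) : U [set n | P n <-> Q n] -> U P <-> U Q.
Proof. by move=> UPQ; split; apply: filterS2 UPQ => n /= []. Qed.

(** Łoś's theorem: maximality of the ultrafilter handles implications, and a
choice of counterexamples in each coordinate handles quantifiers. *)
Lemma ultra_sat V (e : V -> ultrapower) (phi : formula L V) :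
  sat e phi <-> U [set n | sat (ultra_env e n) phi].
Proof.
elim: phi e => {V} [V|V t u|V r args|V phi1 IH1 phi2 IH2|V phi1 IH1] e /=.
- by split=> // /filter_ex[].
- rewrite -[eval e t]ultra_reprK -[eval e u]ultra_reprK ultra_mk_eq.
  apply: ultra_iff; apply: filterS2 (ultra_eval e t) (ultra_eval e u) => n /= -> ->.
  by [].
- apply: ultra_iff.
  apply: filterS (filter_forall _ (fun i => ultra_eval e (args i))) => n /= H.
  suff -> : (fun i => ultra_repr (eval e (args i)) n) =
            (fun i => eval (ultra_env e n) (args i)) by [].
  exact: funext.
- rewrite IH1 IH2; split=> [H|H U1]; last exact: filterS2 H U1.
  have [U1|U1] := in_ultra_setVsetC [set n | sat (ultra_env e n) phi1] UU.
    by apply: (filterS _ (H U1)) => n /= ? _.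
  by apply: (filterS _ U1) => n /= N /N.
- split=> [H|H x]; last first.
    apply/IH1; apply: filterS H => n /= /(_ (ultra_repr x n)).
    by apply: (sat_eq _ _).1 => -[v|].
  apply: contrapT => /ultra_not N.
  have /choice[x xP] n : exists y : M,
      ~ (forall z, sat (fun v => if v is Some w then ultra_env e n w else z) phi1) ->
      ~ sat (fun v => if v is Some w then ultra_env e n w else y) phi1.
    have [p|/existsNP[y yP]] := pselect
      (forall z, sat (fun v => if v is Some w then ultra_env e n w else z) phi1).
      by have [y] := dom_inhabited M; exists y => /(_ p).
    by exists y.
  have := H (ultra_mk x); rewrite IH1 => H1.
  have [n [S [E N']]] := ultra_meet H1 (filterI (ultra_repr_mk x) N).
  by apply: (xP n N'); apply: (sat_eq _ _).1 S => -[v|].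
Qed.

Lemma ultrapower_Th : models ultrapower (Th M).
Proof.
move=> phi Mphi; apply/ultra_sat; apply: filterS filterT => n _ /=.
by apply: (sat_eq _ _).1 Mphi; case.
Qed.

End Ultrapower.

Definition sum_env X V W (x : V -> X) (y : W -> X) (v : V + W) : X :=
  match v with inl i => x i | inr j => y j end.

(** Only finitely many variables matter, so that the tuples may be taken finite;
an ultrapower over the naturals then realizes all traces on the whole sequence
at once, the trace [S] being cut out by the class of a sequence of tuples that
cut out longer and longer initial segments of it. *)
Lemma shattering_not_NIP L (M : structure L) V W (phi : formula L (V + W))
    (x : nat -> V -> M) :
  (forall n (S : set nat), exists y : W -> M,
    forall i, i < n -> sat (sum_env (x i) y) phi <-> S i) ->
  ~ NIP_structure M.
Proof.
move=> shatter nip.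
have [x0] := dom_inhabited M.
have finl : finite_set (inl @^-1` free_vars phi).
  apply: card_le_finite (free_vars_finite phi).
  by apply: (@card_le_injective _ _ _ _ inl) => // u v _ _ [].
have finr : finite_set (inr @^-1` free_vars phi).
  apply: card_le_finite (free_vars_finite phi).
  by apply: (@card_le_injective _ _ _ _ inr) => // u v _ _ [].
have [m [h hP]] := finite_factor finl; have [k [g gP]] := finite_factor finr.
pose hg (v : V + W) : 'I_m.+1 + 'I_k.+1 :=
  match v with inl i => inl (h i) | inr j => inr (g j) end.
have /choice[a aP] i := hP _ x0 (x i).
have /choice[b bP] (p : set nat * nat) : exists b : 'I_k.+1 -> M,
    forall i, i < p.2 -> sat (sum_env (a i) b) (rename hg phi) <-> p.1 i.
  have [y yP] := shatter p.2 p.1; have [b bP] := gP _ x0 y.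
  exists b => i ip; rewrite -yP // sat_rename; apply: sat_agree => -[v|w] /= pv.
    exact: aP.
  exact: bP.
have [U [UU Uinf]] := ultraFilterLemma eventually_filter.
apply: (nip _ _ (rename hg phi)).
exists (ultrapower M U), (fun i j => ultra_mk U (fun=> a i j)),
  (fun S j => ultra_mk U (fun n => b (S, n) j)).
split=> [|i S]; first exact: ultrapower_Th.
rewrite ultra_sat.
have Ui : U [set n | sat (sum_env (a i) (b (S, n))) (rename hg phi) <-> S i].
  by apply: Uinf; exists i.+1 => // n /= iN; apply: bP.
set e := (X in ultra_env X).
have Ue : U [set n | ultra_env e n = sum_env (a i) (b (S, n))].
  have U1 : U [set n | forall j, ultra_repr (ultra_mk U (fun=> a i j)) n = a i j].
    by apply: filter_forall => j; apply: ultra_repr_mk.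
  have U2 : U [set n | forall j,
      ultra_repr (ultra_mk U (fun n => b (S, n) j)) n = b (S, n) j].
    by apply: filter_forall => j; apply: ultra_repr_mk.
  apply: filterS2 U1 U2 => n /= H1 H2; apply: funext => -[j|j] /=.
    exact: H1.
  exact: H2.
split=> [H|Si].
  by have [n [E1 [E2 E3]]] := ultra_meet UU Ui (filterI Ue H); apply/E1; rewrite -E2.
by apply: filterS2 Ui Ue => n /= E1 E2; rewrite E2; apply/E1.
Qed.

(** * Independence in terms of automorphisms *)

Definition fixing L (M : structure L) (C : set M) (s : M -> M) : Prop :=
  automorphism s /\ forall x, C x -> s x = x.

Section Fixing.
Variables (L : language) (M : structure L).
Implicit Types (C : set M) (s : M -> M).

Lemma fixing_sub C C' s : C `<=` C' -> fixing C' s -> fixing C s.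
Proof. by move=> CC' [sA sC]; split=> // x /CC'; apply: sC. Qed.

Lemma fixing_comp C s s' : fixing C s -> fixing C s' -> fixing C (s \o s').
Proof.
move=> [sA sC] [s'A s'C]; split; first exact: automorphism_comp.
by move=> x Cx /=; rewrite s'C ?sC.
Qed.

Lemma fixing_inv C s : fixing C s ->
  exists s', [/\ fixing C s', cancel s s' & cancel s' s].
Proof.
move=> [sA sC]; have [s' [s'A sK s'K]] := automorphism_inv sA.
by exists s'; split=> //; split=> // x Cx; rewrite -[in LHS](sC _ Cx) sK.
Qed.

Lemma fixing_image C D s : fixing C s -> D `<=` C -> s @` D = D.
Proof.
move=> [_ sC] DC; apply/seteqP; split=> [_ [x Dx <-]|x Dx].
  by rewrite sC //; apply: DC.
by exists x => //; apply/sC/DC.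
Qed.

Lemma range_comp I s (e : I -> M) : range (s \o e) = s @` range e.
Proof. by rewrite image_comp. Qed.

Lemma imageK s s' (X : set M) : cancel s s' -> s' @` (s @` X) = X.
Proof.
move=> sK; rewrite image_comp; apply/seteqP; split=> [_ [x Xx <-]|x Xx] /=.
  by rewrite sK.
by exists x => //=; rewrite sK.
Qed.

Lemma fixing_eqtp C s I (a : I -> M) : fixing C s -> eqtp C (s \o a) a.
Proof.
move=> [sA sC]; apply/seteqP; split=> phi /=.
  move=> H; apply/(automorphism_sat _ _ sA); apply: (sat_eq _ _).1 H => -[i|d] //=.
  by rewrite sC //; apply: set_valP.
move/(automorphism_sat _ _ sA); apply: (sat_eq _ _).1 => -[i|d] //=.
by rewrite sC //; apply: set_valP.
Qed.

End Fixing.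

Section Independence.
Variables (L : language) (M : structure L) (K : Type).
Variable ind : set M -> set M -> set M -> Prop.
Hypothesis K_strong_limit : strong_limit K.
Hypothesis K_nat : small K [set: nat].
Hypothesis homogeneity : strongly_homogeneous K M.

Lemma small_ordinal n : small K [set: 'I_n].
Proof. by apply: small_finite => //; apply: finite_finset. Qed.

Lemma small_option X : small K [set: X] -> small K [set: option X].
Proof.
move=> sX; apply: (@small_sub _ _ _ (Some @` setT `|` [set None])).
  by move=> [x|] _; [left; exists x|right].
by apply: small_setU1 => //; apply: small_image.
Qed.

(** Homogeneity is about types over the empty set; the parameters are moved into
the tuple. *)
Lemma eqtp_fixing (C : set M) I (a a' : I -> M) :
  small K C -> small K [set: I] -> eqtp C a a' ->
  exists2 s, fixing C s & forall i, s (a i) = a' i.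
Proof.
move=> sC sI aa'.
have sIC : small K [set: I + set_type C].
  by apply: small_sum => //; apply: small_type.
have tpE0 : eqtp set0 (sum_env a (@set_val _ C)) (sum_env a' (@set_val _ C)).
  pose h (v : (I + set_type C) + set_type (set0 : set M)) : I + set_type C :=
    match v with inl w => w | inr d => False_rect _ (set_valP d) end.
  have tpE (b : I -> M) phi :
      tp set0 (sum_env b (@set_val _ C)) phi <-> tp C b (rename h phi).
    rewrite /tp /= sat_rename; apply: sat_eq => -[[i|d]|d] //=.
    by case: (set_valP d).
  by apply/seteqP; split=> phi /tpE H; apply/tpE; [rewrite -aa'|rewrite aa'].
have [s [sA sP]] := homogeneity sIC tpE0.
exists s; last by move=> i; apply: (sP (inl i)).
split=> // x Cx; exact: (sP (inr (exist _ x (mem_set Cx)))).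
Qed.

Hypothesis ind_invariance : invariance K ind.
Hypothesis ind_monotonicity : monotonicity K ind.
Hypothesis ind_strong_finite : strong_finite_character K ind.
Hypothesis ind_base : base_monotonicity K ind.
Hypothesis ind_left_trans : left_transitivity K ind.
Hypothesis ind_right_ext : right_extension K ind.

Lemma ind_mono (a a' C b b' : set M) :
  small K a -> small K C -> small K b -> a' `<=` a -> b' `<=` b ->
  ind a C b -> ind a' C b'.
Proof.
move=> sa sC sb a'a b'b; rewrite -(setUidr a'a) -(setUidr b'b).
by apply: ind_monotonicity => //; [apply: small_sub a'a sa|apply: small_sub b'b sb].
Qed.

Lemma ind_fixing (C : set M) s a b : small K a -> small K C -> small K b ->
  fixing C s -> ind a C b -> ind (s @` a) C (s @` b).
Proof.
move=> sa sC sb sfix /(ind_invariance sa sC sb sfix.1).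
by rewrite (fixing_image sfix (@subset_refl _ C)).
Qed.

(** Right extension, with the new copy given by an automorphism. *)
Lemma ind_right_fixing (a C b c : set M) :
  small K a -> small K C -> small K b -> small K c -> ind a C b ->
  exists2 s, fixing (C `|` b) s & ind a C (b `|` s @` c).
Proof.
move=> sa sC sb sc ab.
have [c' c'c ac'] := ind_right_ext (@set_val _ c) sa sC sb (small_type sc) ab.
have [||s sfix sP] := eqtp_fixing _ _ (esym c'c); [exact: small_setU|exact: small_type|].
exists s => //; suff <- : range c' = s @` c by [].
apply/seteqP; split=> [_ [i _ <-]|_ [x cx <-]].
  by exists (set_val i); [apply: set_valP|rewrite sP].
by exists (exist _ x (mem_set cx)) => //; rewrite -sP.
Qed.

(** The base may be added on the right: an extension of [b] by a copy of [C]
over [C] is an extension by [C] itself. *)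
Lemma ind_add_base (a C b : set M) : small K a -> small K C -> small K b ->
  ind a C b -> ind a C (b `|` C).
Proof.
move=> sa sC sb ab; have [s sfix] := ind_right_fixing sa sC sb sC ab.
by rewrite (fixing_image sfix) // => x; left.
Qed.

(** Base monotonicity moves [y] into the base, where left transitivity applies. *)
Lemma ind_chain (x y C b : set M) :
  small K x -> small K y -> small K C -> small K b ->
  ind x C (y `|` b) -> ind y C b -> ind (x `|` y) C b.
Proof.
move=> sx sy sC sb xyb yb; apply: ind_left_trans => //.
exact: ind_base.
Qed.

(** The formula given by strong finite character mentions a finite part [F] of
[a]. Were [F] independent, a tuple that agrees with [a] on [F] and takes all its
values in [F] would satisfy the formula and yet be independent. *)
Lemma ind_finite_character (a C b : set M) :
  small K a -> small K C -> small K b -> ~ ind a C b ->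
  exists F, [/\ finite_set F, F `<=` a & ~ ind F C b].
Proof.
move=> sa sC sb Nab; have [a0|/set0P[x0 ax0]] := eqVneq a set0.
  by exists set0; rewrite -{2 3}a0; split=> //; apply: finite_set0.
have aE : a = range (@set_val _ a).
  apply/seteqP; split=> [x ax|_ [x _ <-]]; last exact: set_valP.
  by exists (exist _ x (mem_set ax)).
have [|phi phi_a Nphi] := ind_strong_finite (small_type sa) sC sb (a := @set_val _ a).
  by rewrite -aE.
have fin : finite_set (inl @^-1` free_vars phi).
  apply: card_le_finite (free_vars_finite phi).
  by apply: (@card_le_injective _ _ _ _ inl) => // u v _ _ [].
have [n [h hP]] := finite_factor fin.
have [e eP] := hP _ (exist _ x0 (mem_set ax0)) (@id (set_type a)).
exists (range (set_val \o e)); split.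
- by apply: finite_image; apply: finite_finset.
- by move=> _ [i _ <-]; apply: set_valP.
- move=> Fb; have := Nphi (set_val \o e \o h); apply.
    move: phi_a; rewrite /tp /=; apply: (sat_agree _).1 => -[v|d] //= pv.
    by rewrite eP.
  apply: ind_mono Fb => //; last by move=> _ [v _ <-]; exists (h v).
  by apply: small_finite => //; apply: finite_image; apply: finite_finset.
Qed.

Lemma finite_range (F : set M) :
  finite_set F -> exists n (g : 'I_n -> M), range g = F.
Proof.
move=> [n Fn]; exists n.
have /card_eqP[f] : [set: 'I_n] #= F.
  by rewrite card_eq_sym; apply: card_eq_trans Fn _; apply: card_II.
exists (fun i => set_val (f (exist _ i (mem_set I)))).
apply/seteqP; split=> [_ [i _ <-]|x Fx]; first exact: set_valP.
have [i _ fi] := @surj _ _ _ _ f (exist _ x (mem_set Fx)) I.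
exists (set_val i) => //; rewrite -[RHS]/(set_val (exist _ x (mem_set Fx))) -fi.
by congr (set_val (f _)); apply: val_inj.
Qed.

Section Tuples.
Variable A : set M.
Hypothesis A_small : small K A.

(** * A small set of representatives *)

Section Representatives.
Variables (n : nat) (b0 : 'I_n -> M) (I : Type) (e0 : I -> M).
Hypothesis I_small : small K [set: I].

(** Equality of types over [A], here and below, means conjugacy under the
automorphisms fixing [A]. *)
Definition same_type (b' : 'I_n -> M) (e : I -> M) :=
  exists s, [/\ fixing A s, s \o b0 = b' & s \o e0 = e].

Definition twin (e e' : I -> M) :=
  forall b', ind (range b') A (range e `|` range e') ->
    same_type b' e <-> same_type b' e'.

Lemma same_type_fixing s b' e :
  fixing A s -> same_type b' e -> same_type (s \o b') (s \o e).
Proof.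
by move=> sfix [t [tfix <- <-]]; exists (s \o t); split=> //; apply: fixing_comp.
Qed.

Lemma twin_sym e e' : twin e e' -> twin e' e.
Proof. by move=> ee' b'; rewrite setUC => /ee'[]. Qed.

Lemma small_tuple k (b : 'I_k -> M) : small K (range b).
Proof. exact/small_range/small_ordinal. Qed.

Lemma twin_fixing s e e' : fixing A s -> twin e e' -> twin (s \o e) (s \o e').
Proof.
move=> sfix ee' b' b'ee'.
have [t [tfix sK tK]] := fixing_inv sfix.
have back f : same_type b' (s \o f) <-> same_type (t \o b') f.
  split=> [/(same_type_fixing tfix)|/(same_type_fixing sfix)].
    by suff -> : t \o (s \o f) = f by []; apply: funext => i /=; rewrite sK.
  by suff -> : s \o (t \o b') = b' by []; apply: funext => i /=; rewrite tK.
rewrite !back; apply: ee'.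
rewrite (range_comp t) -(imageK (range e) sK) -(imageK (range e') sK) -image_setU.
rewrite -(range_comp s e) -(range_comp s e'); apply: ind_fixing => //; first exact: small_tuple.
by apply: small_setU => //; apply: small_range.
Qed.

(** Non-twins are separated by some independent type, and right extension lifts
this type to a common domain [D]. So a tuple is determined by the set of those
independent types over [D] that relate to it as [b0] to [e0], and there are only
boundedly many types to choose from. As [D] has to be small, the argument is
applied to a subfamily of size two power sets above the bound, which exists
unless the family is small already, and contradicts Cantor's theorem. *)
Lemma non_twins_small (R : set (I -> M)) :
  bounded K ind -> (forall r r', R r -> R r' -> twin r r' -> r = r') -> small K R.
Proof.
move=> [f [_ f_small f_bound]] R_twin.
pose Y := f (set_type A).
have sY : small K [set: Y] by apply/f_small/small_type.
have sYY : small K [set: set (set Y)] by apply/K_strong_limit/K_strong_limit.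
have [RY|] := card_le_total R [set: set (set Y)]; first exact: small_le RY sYY.
move=> YR; have [j j_inj jR] := card_le_fun YR; exfalso.
pose J := set_type [set: set (set Y)].
have sJ : small K [set: J] by apply: small_type.
pose D := A `|` range (fun p : J * I => j p.1 p.2).
have sD : small K D.
  by apply: small_setU => //; apply: small_range; apply: small_prod.
have AD : A `<=` D by left.
have jD k : range (j k) `<=` D by move=> _ [i _ <-]; right; exists (k, i).
have p_complete : complete_type (tp A b0).
  split; first by move=> F _ Fp; exists b0.
  by move=> phi; have [H|H] := pselect (tp A b0 phi); [left|right].
have [g g_inj _] := card_le_fun (f_bound A D n (tp A b0) A_small sD AD p_complete).
set Sigma := (X in set_type X) in g g_inj.
have Sigma_tp b' r : ind (range b') A D -> same_type b' r -> Sigma (tp D b').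
  move=> b'D [s [sfix b'E _]]; exists b' => //; split=> //.
  by rewrite /realizes -b'E (fixing_eqtp b0 sfix).
pose good (k : J) : set Y := [set y | exists b' (H : Sigma (tp D b')),
  g (set_elem H) = y /\ same_type b' (j k)].
(* The separating tuple [b'] is first moved to [t \o b'], independent from all of
[D]; the automorphism [t] fixes both tuples to be separated. *)
have sep k k' b' : ind (range b') A (range (j k) `|` range (j k')) ->
    same_type b' (j k) -> good k `<=` good k' -> same_type b' (j k').
  move=> b'kk' b'k sub.
  have sjj : small K (range (j k) `|` range (j k')).
    by apply: small_setU => //; apply: small_range.
  have [s sfix b's] := ind_right_fixing (small_tuple b') A_small sjj sD b'kk'.
  have [t [tfix sK tK]] := fixing_inv sfix.
  have tA : fixing A t by apply: fixing_sub tfix => x; left.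
  have sA : fixing A s by apply: fixing_sub sfix => x; left.
  have tj l : l = k \/ l = k' -> t \o j l = j l.
    move=> lk; apply: funext => i; apply: tfix.2; right.
    by case: lk => ->; [left|right]; exists i.
  have tb'D : ind (range (t \o b')) A D.
    rewrite range_comp -(imageK D sK).
    apply: (ind_fixing _ _ _ tA) => //; [exact: small_tuple|exact: small_image|].
    apply: (ind_mono (small_tuple b') A_small _ (@subset_refl _ _) _ b's).
      by apply: small_setU => //; apply: small_image.
    by move=> x; right.
  have tb'k : same_type (t \o b') (j k).
    by rewrite -(tj k); [apply: same_type_fixing|left].
  have H := Sigma_tp _ _ tb'D tb'k.
  have [|b3 [H3 [/g_inj[E] b3k']]] := sub (g (set_elem H)).
    by exists (t \o b'), H.
  have [u ufix uP] := eqtp_fixing sD (small_ordinal n) E.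
  have uA : fixing A u by apply: fixing_sub ufix.
  have := same_type_fixing uA b3k'.
  have -> : u \o j k' = j k'.
    by apply: funext => i; apply: ufix.2; apply: jD; exists i.
  have -> : u \o b3 = t \o b' by apply: funext.
  move=> /(same_type_fixing sA).
  have -> : s \o (t \o b') = b' by apply: funext => i /=; rewrite tK.
  suff -> : s \o j k' = j k' by [].
  by rewrite -[in LHS](tj k'); [apply: funext => i /=; rewrite tK|right].
have good_inj : injective good.
  move=> k k' kk'; apply/j_inj/R_twin => // b' b'kk'.
  split=> H; first by apply: sep b'kk' H _; rewrite kk'.
  by move: b'kk'; rewrite setUC => /sep; apply; rewrite // kk'.
apply: (@cantor (set Y) (fun x => good (set_elem (Logic.I : setT x)))).
by move=> x x' /good_inj[].
Qed.

(** A maximal set of pairwise non-twins is a set of representatives. *)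
Lemma twin_representatives : bounded K ind ->
  exists2 R : set (I -> M), small K R &
    (forall r, R r -> exists2 s, fixing A s & s \o e0 = r) /\
    (forall s, fixing A s -> exists2 r, R r & twin (s \o e0) r).
Proof.
move=> bnd.
pose indep (R : set (I -> M)) :=
  (forall r, R r -> exists2 s, fixing A s & s \o e0 = r) /\
  (forall r r', R r -> R r' -> twin r r' -> r = r').
have [|R [[Rorb Rtwin] Rmax]] := @Zorn_bigcup _ indep.
  move=> F Find Ftot; split=> [r [X FX Xr]|r r' [X FX Xr] [X' FX' X'r']].
    exact: (Find _ FX).1.
  have [XX'|X'X] := Ftot _ _ FX FX'.
    by apply: (Find _ FX').2 => //; apply: XX'.
  by apply: (Find _ FX).2 => //; apply: X'X.
exists R; first exact: non_twins_small.
split=> // s sfix; apply: contrapT => noR.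
have Ntwin r : R r -> ~ twin (s \o e0) r by move=> Rr ?; apply: noR; exists r.
apply: (Rmax (R `|` [set s \o e0])).
  split=> [r Rr|sub]; first by left.
  by apply: (Ntwin (s \o e0)) => //; apply: sub; right.
split=> [r [/Rorb //|->]|r r' [Rr|->] [Rr'|->] // rr']; first by exists s.
- exact: Rtwin.
- by case: (Ntwin _ Rr); apply: twin_sym.
- by case: (Ntwin _ Rr').
Qed.

End Representatives.
(** * A sequence of independent copies *)

Section Copies.
Variables (a : set M) (n : nat) (b0 : 'I_n -> M).
Hypothesis a_small : small K a.
Hypothesis b0a : ind (range b0) A a.
Hypothesis ind_bounded : bounded K ind.
Hypothesis A_base : extension_base K ind A.

(* Enumerating [A] together with [a] lets the formulas with parameters in either
set be read as formulas about a tuple. *)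
Let e0 : set_type (A `|` a) -> M := @set_val _ (A `|` a).

Lemma index_small : small K [set: set_type (A `|` a)].
Proof. by apply: small_type; apply: small_setU. Qed.

Lemma range_e0 : range e0 = A `|` a.
Proof.
apply/seteqP; split=> [_ [i _ <-]|x xAa]; first exact: set_valP.
by exists (set_elem xAa).
Qed.

(** The set of representatives can be moved over [A] so that [a] is independent
from it, and it remains a set of representatives. *)
Lemma independent_twin : exists e1, [/\ twin b0 e0 e0 e1, A `<=` range e1
  & ind a A (range e1)].
Proof.
have [R sR [Rorb Rtwin]] := twin_representatives b0 e0 index_small ind_bounded.
pose D := range (fun p : set_type R * set_type (A `|` a) => set_val p.1 p.2).
have sD : small K D.
  by apply/small_range/small_prod => //; [apply: small_type|apply: index_small].
have [s sfix asD] := ind_right_fixing a_small A_small A_small sD (A_base a_small).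
have {}sfix : fixing A s by apply: fixing_sub sfix => x; left.
have [t [tfix sK tK]] := fixing_inv sfix.
have [r Rr tr] := Rtwin _ tfix.
exists (s \o r); split.
- have := twin_fixing index_small sfix tr.
  by suff -> : s \o (t \o e0) = e0 by []; apply: funext => i /=; rewrite tK.
- move=> x Ax; have [u ufix <-] := Rorb _ Rr.
  exists (set_elem (or_introl Ax : (A `|` a) x)) => //.
  by transitivity (s (u x)); rewrite // ufix.2 // sfix.2.
- apply: (ind_mono _ _ _ _ _ asD) => //.
    by apply: small_setU => //; apply: small_image.
  move=> _ [i _ <-]; right; exists (r i) => //.
  by exists (set_elem Rr, i).
Qed.

(** A conjugate [bh] of [b0] over [a] is independent from [a] and its twin [e1]
together, so that [bh] relates to [e1] as to [a]. The copies of [(bh, a)] are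
taken over [e1]: the copy [b_s] still relates to [e1] in this way, hence also to
each [a_t] with [t < s], since [a_t] is a twin of [e1] and [b_s] is independent
from both. *)
Lemma independent_copies : exists (sg : nat -> M -> M) (bh : 'I_n -> M),
  [/\ forall i, fixing A (sg i),
      forall i, ind (sg i @` (range bh `|` a)) A
                    (\bigcup_(j in `I_i) (sg j @` (range bh `|` a)))
    & forall t s, t < s -> same_type b0 e0 (sg s \o bh) (sg t \o e0)].
Proof.
have [e1 [e01 AE aE]] := independent_twin.
set E := range e1 in AE aE.
have sE : small K E by apply/small_range/index_small.
have [r rfix b0E] := ind_right_fixing (small_tuple b0) A_small a_small sE b0a.
have [r' [r'fix rK r'K]] := fixing_inv rfix.
have r'A : fixing A r' by apply: fixing_sub r'fix => x; left.
pose bh := r' \o b0.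
have sbh : small K (range bh) by apply: small_tuple.
pose dh := range bh `|` a.
have sdh : small K dh by apply: small_setU.
have bhE : ind (range bh) A (a `|` E).
  rewrite range_comp -(imageK E rK).
  rewrite -[X in X `|` _](fixing_image r'fix (@subsetUr _ _ _)) -image_setU.
  apply: (ind_fixing (small_tuple b0) A_small _ r'A b0E).
  by apply: small_setU => //; apply: small_image.
have dhE : ind dh A E by apply: ind_chain.
have bh_e0 : same_type b0 e0 bh e0.
  exists r'; split=> //; apply: funext => i /=.
  by rewrite r'fix.2 //; apply: set_valP.
have bh_e1 : same_type b0 e0 bh e1.
  apply/(e01 bh) => //; rewrite range_e0.
  have saE : small K (a `|` E) by apply: small_setU.
  apply: (ind_mono sbh A_small _ _ _ (ind_add_base sbh A_small saE bhE)) => //.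
    exact: small_setU.
  by move=> x [[Ax|ax]|Ex]; [right|left; left|left; right].
have /choice[step stepP] (B : set M) : exists s, small K B ->
    fixing E s /\ ind (s @` dh) A (E `|` B).
  have [sB|NsB] := pselect (small K B); last by exists id.
  have [s sfix dhs] := ind_right_fixing sdh A_small sE sB dhE.
  have [s' [s'fix sK s'K]] := fixing_inv sfix.
  exists s' => _; split; first by apply: fixing_sub s'fix; right.
  rewrite -(imageK B sK).
  rewrite -[X in X `|` _](fixing_image s'fix (@subsetUr _ _ _)) -image_setU.
  apply: (ind_fixing sdh A_small).
  - by apply: small_setU => //; apply: small_image.
  - by apply: fixing_sub s'fix => x; left.
  - exact: dhs.
(* [B i] collects the copies with index below [i]. *)
pose B := fix B i := if i is j.+1 then B j `|` step (B j) @` dh else set0.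
have sB i : small K (B i).
  elim: i => [|i IH] /=; first by apply: small_finite => //; apply: finite_set0.
  by apply: small_setU => //; apply: small_image.
pose sg i := step (B i).
have sgE i : fixing E (sg i) by have [] := stepP _ (sB i).
have sgA i : fixing A (sg i) by apply: fixing_sub (sgE i).
have sgB i : ind (sg i @` dh) A (E `|` B i) by have [] := stepP _ (sB i).
have inB i j : j < i -> sg j @` dh `<=` B i.
  elim: i => // i IH; rewrite ltnS leq_eqVlt => /predU1P[->|/IH sub] x; first by right.
  by move=> /sub; left.
exists sg, bh; split=> // [i|t s ts].
  apply: ind_mono (sgB i).
  - exact: small_image.
  - by [].
  - exact: small_setU.
  - by [].
  - by move=> x [j /= ji xj]; right; apply: inB xj.
have [p [pE tK ptK]] := fixing_inv (sgE t).
have pA : fixing A p by apply: fixing_sub pE.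
have p_e1 : p \o (sg s \o e1) = e1.
  apply: funext => i /=; have Ei : E (e1 i) by exists i.
  by rewrite (sgE s).2 // pE.2.
have pb_e1 : same_type b0 e0 (p \o (sg s \o bh)) e1.
  by rewrite -p_e1; do 2 apply: same_type_fixing => //.
have pb_e0 : same_type b0 e0 (p \o (sg s \o bh)) e0.
  apply/(e01 (p \o (sg s \o bh))) => //; rewrite range_e0.
  have sbE : ind (sg s @` range bh) A (E `|` sg t @` a).
    apply: ind_mono (sgB s).
    - exact: small_image.
    - by [].
    - exact: small_setU.
    - by apply: image_subset; left.
    - by move=> x [|[y ay <-]]; [left|right; apply: (inB _ _ ts); exists y => //; right].
  have sb2 : small K (sg s @` range bh) by apply: small_image.
  have sEa : small K (E `|` sg t @` a) by apply: small_setU => //; apply: small_image.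
  have := ind_fixing sb2 A_small sEa pA sbE.
  rewrite image_setU (imageK a tK) (fixing_image pE (@subset_refl _ _)).
  rewrite -!range_comp => pb_Ea; have st := small_tuple (p \o (sg s \o bh)).
  have sEa' : small K (E `|` a) by apply: small_setU.
  apply: (ind_mono st A_small _ _ _ (ind_add_base st A_small sEa' pb_Ea)) => //.
    exact: small_setU.
  by move=> x [[Ax|ax]|Ex]; [right|left; right|left; left].
(* All of this was conjugated by [p], the inverse of [sg t]. *)
suff <- : sg t \o (p \o (sg s \o bh)) = sg s \o bh by apply: same_type_fixing.
by apply: funext => i /=; rewrite ptK.
Qed.

End Copies.

(** * Coding pairs by single elements *)

Section Coding.
Variables (sg : nat -> M -> M) (d : set M).
Hypothesis d_small : small K d.

Definition segment (P : set nat) : set M := \bigcup_(j in P) (sg j @` d).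

Lemma segment_small P : small K (segment P).
Proof.
apply: (@small_sub _ _ _ (range (fun p : nat * set_type d => sg p.1 (set_val p.2)))).
  by move=> _ [j Pj [x dx <-]]; exists (j, set_elem dx).
by apply/small_range/small_prod => //; apply: small_type.
Qed.

Lemma segment_sub P Q : P `<=` Q -> segment P `<=` segment Q.
Proof. by move=> PQ x [j Pj xj]; exists j => //; apply: PQ. Qed.

Hypothesis copies_independent :
  forall i, ind (sg i @` d) A (segment `I_i).

(** Finite segments are handled by induction on their length, chaining the
independence of the last copy with that of the previous ones; infinite segments
then follow by finite character. *)
Lemma segment_independent s :
  ind (segment [set j | s <= j]) A (segment `I_s).
Proof.
have fin N : ind (segment [set j | s <= j < N]) A (segment `I_s).
  elim: N => [|N IH].
    have := copies_independent s; apply: ind_mono => //; last by move=> x [j /=]; lia.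
      exact: small_image.
    exact: segment_small.
  have [Ns|sN] := ltnP N s.
    apply: (ind_mono _ _ _ _ _ IH) => //; do ?exact: segment_small.
    by apply: segment_sub => j /=; lia.
  have chain : ind (sg N @` d `|` segment [set j | s <= j < N]) A (segment `I_s).
    apply: ind_chain => //; do ?[exact: segment_small|exact: small_image].
    apply: (ind_mono _ _ _ _ _ (copies_independent N)) => //;
      do ?[exact: segment_small|exact: small_image].
    by move=> x [|]; apply: segment_sub => j /=; lia.
  apply: (ind_mono _ _ _ _ _ chain) => //; do ?exact: segment_small.
    by apply: small_setU => //; [apply: small_image|apply: segment_small].
  move=> x [j /= /andP[sj]]; rewrite ltnS leq_eqVlt => /predU1P[->|jN] xj.
    by left.
  by right; exists j => //=; rewrite sj.
apply: contrapT => /(ind_finite_character (segment_small _) A_small (segment_small _)).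
move=> [F [/finite_range[k [g <-]] gs]]; apply.
have /choice[m mP] i : exists m, s <= m /\ (sg m @` d) (g i).
  by have [|m /= sm gm] := gs (g i); [exists i|exists m].
apply: (ind_mono _ _ _ _ _ (fin (\max_i m i).+1)) => //; do ?exact: segment_small.
move=> _ [i _ <-]; exists (m i); last exact: (mP i).2.
by rewrite /= (mP i).1 ltnS leq_bigmax.
Qed.

(** Left extension, with the new copy given by an automorphism. *)
Lemma ind_left_fixing (x y c : set M) : left_extension_over K ind A ->
  small K x -> small K y -> small K c -> ind x A y ->
  exists2 s, fixing (A `|` x) s & ind (x `|` s @` c) A y.
Proof.
move=> lext sx sy sc xy.
have [c' c'c xc'] := lext x y _ (@set_val _ c) sx sy (small_type sc) xy.
have sAx : small K (A `|` x) by apply: small_setU.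
have [s sfix sP] := eqtp_fixing sAx (small_type sc) (esym c'c).
exists s => //; suff <- : range c' = s @` c by [].
apply/seteqP; split=> [_ [i _ <-]|_ [z cz <-]].
  by exists (set_val i); [apply: set_valP|rewrite sP].
by exists (set_elem cz) => //; rewrite -sP.
Qed.

(** An element [r c] lying over two members of the sequence can be moved away
from the rest of it: left extension frees it, together with what lies between
the two members, from the earlier copies, and then right extension frees the
later copies from it. *)
Lemma coding_element (c : M) t s r : left_extension_over K ind A ->
  t <= s -> fixing A r -> exists u, [/\ fixing (A `|` segment [set j | t <= j <= s]) u,
    ind (segment [set j | s < j]) A (segment `I_s.+1 `|` [set u (r c)])
    & ind (segment [set j | t <= j] `|` [set u (r c)]) A (segment `I_t)].
Proof.
move=> lext ts rfix.
(* [k] comes from left extension and [l] from right extension. The independence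
obtained by [k] survives [l], which fixes both sides of it up to the new
element. *)
pose W := segment [set j | t <= j <= s].
have sW : small K W by apply: segment_small.
have Wt : ind W A (segment `I_t).
  apply: (ind_mono _ _ _ _ _ (segment_independent t)) => //; do ?exact: segment_small.
  by apply: segment_sub => j /= /andP[].
have [k kfix] := ind_left_fixing lext sW (segment_small _) (small_set1 K_nat (r c)) Wt.
rewrite image_set1 => Wkt.
have skc : small K [set k (r c)] by apply: small_set1.
have [l lfix] := ind_right_fixing (segment_small _) A_small (segment_small _) skc
  (segment_independent s.+1).
rewrite image_set1 => lks.
have lW : fixing (A `|` W) l.
  by apply: fixing_sub lfix => x [|Wx]; [left|right; apply: segment_sub Wx => j /=; lia].
exists (l \o k); split=> //=; first exact: fixing_comp.
have sWl : small K (W `|` [set l (k (r c))]) by apply: small_setU1.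
have Wlt : ind (W `|` [set l (k (r c))]) A (segment `I_t).
  have sWk : small K (W `|` [set k (r c)]) by apply: small_setU.
  have := ind_fixing sWk A_small (segment_small _) (fixing_sub _ lfix) Wkt.
  rewrite image_setU image_set1 (fixing_image lW (@subsetUr _ _ _)).
  rewrite (fixing_image lfix); first by apply=> x; left.
  by move=> x Bx; right; apply: segment_sub Bx => j /=; lia.
have chain : ind (segment [set j | s < j] `|` (W `|` [set l (k (r c))])) A (segment `I_t).
  apply: ind_chain => //; do ?exact: segment_small.
  apply: (ind_mono _ _ _ _ _ lks) => //; first exact: segment_small.
    by apply: small_setU1 => //; apply: segment_small.
  move=> x [[Wx|->]|Bx]; [left|by right|left].
    by apply: segment_sub Wx => j /=; lia.
  by apply: segment_sub Bx => j /=; lia.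
apply: (ind_mono _ _ _ _ _ chain) => //; last 1 first.
- move=> x [[j /= tj xj]|->]; last by right; right.
  have [js|sj] := leqP j s; last by left; exists j.
  by right; left; exists j => //=; rewrite tj.
- by apply: small_setU => //; apply: segment_small.
- exact: segment_small.
Qed.

End Coding.

(** * The formula that forbids both independences *)

Definition triple_env X Y n (b : 'I_n -> X) (e : Y -> X) (z : X) :
    'I_n + Y + unit -> X :=
  sum_env (sum_env b e) (fun=> z).

Section Formula.
Variables (a : set M) (n : nat) (b0 : 'I_n -> M) (c : M).
Hypothesis a_small : small K a.

Let e0 : set_type (A `|` a) -> M := @set_val _ (A `|` a).

(** The conjunction of the two formulas given by strong finite character. Their
parameters have become variables, so that the conclusions transfer to all
conjugates over [A] of [a], and of [ac] respectively. *)
Lemma dependence_formula :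
  ~ ind (range b0 `|` [set c]) A a -> ~ ind (range b0) A (a `|` [set c]) ->
  exists theta : formula L ('I_n + set_type (A `|` a) + unit),
  [/\ sat (triple_env b0 e0 c) theta,
      forall s b' c', fixing A s -> sat (triple_env b' (s \o e0) c') theta ->
        ~ ind (range b' `|` [set c']) A (s @` a)
    & forall s b', fixing A s -> sat (triple_env b' (s \o e0) (s c)) theta ->
        ~ ind (range b') A (s @` (a `|` [set c]))].
Proof.
move=> Nbc_a Nb_ac.
pose join (b : 'I_n -> M) z o := if o is Some i then b i else z.
have range_join b z : range (join b z) = range b `|` [set z].
  apply/seteqP; split=> [_ [[i|] _ <-]|x [[i _ <-]|->]]; [by left; exists i|by right| |].
    by exists (Some i).
  by exists None.
have sac : small K (a `|` [set c]) by apply: small_setU1.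
have [|phi phi_bc Nphi] :=
    ind_strong_finite (small_option (small_ordinal n)) A_small a_small (a := join b0 c).
  by rewrite range_join.
have [psi psi_b Npsi] := ind_strong_finite (small_ordinal n) A_small sac Nb_ac.
pose fphi (v : option 'I_n + set_type (A `|` a)) : 'I_n + set_type (A `|` a) + unit :=
  match v with
  | inl (Some i) => inl (inl i)
  | inl None => inr tt
  | inr p => inl (inr p)
  end.
pose fpsi (v : 'I_n + set_type (A `|` (a `|` [set c]))) :
    'I_n + set_type (A `|` a) + unit :=
  match v with
  | inl i => inl (inl i)
  | inr p => if pselect ((A `|` a) (set_val p)) is left Aap
             then inl (inr (set_elem Aap)) else inr tt
  end.
have phiE s b' z : (forall x, (A `|` a) x -> s x = x) ->
    sat (triple_env b' (s \o e0) z) (rename fphi phi) <-> tp (A `|` a) (join b' z) phi.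
  move=> sAa; rewrite sat_rename /tp /=; apply: sat_eq => -[[i|]|p] //=.
  by apply: sAa; apply: set_valP.
have psiE s b' : (forall x, (A `|` a) x -> s x = x) ->
    sat (triple_env b' (s \o e0) c) (rename fpsi psi) <->
    tp (A `|` (a `|` [set c])) b' psi.
  move=> sAa; rewrite sat_rename /tp /=; apply: sat_eq => -[i|p] //=.
  case: pselect => [Aap|NAap] /=; first by rewrite sAa.
  have [Ap|[ap|pc]] := set_valP p; last exact: esym.
    by case: NAap; left.
  by case: NAap; right.
exists (FAnd (rename fphi phi) (rename fpsi psi)); split.
- by apply/sat_and; split; [apply/(phiE id)|apply/(psiE id)].
- move=> s b' c' sfix /sat_and[phi_s _] ind_s.
  have [t [tfix sK tK]] := fixing_inv sfix.
  apply: (Nphi (join (t \o b') (t c'))).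
    apply/(phiE id) => //; move/(automorphism_sat _ _ tfix.1): phi_s.
    by apply: (sat_eq _ _).1 => -[[i|p]|] //=; rewrite sK.
  have ssa : small K (s @` a) by apply: small_image.
  have sbc : small K (range b' `|` [set c']) by apply: small_setU1 => //; apply: small_tuple.
  have := ind_fixing sbc A_small ssa tfix ind_s.
  by rewrite (imageK a sK) image_setU image_set1 -range_comp range_join.
- move=> s b' sfix /sat_and[_ psi_s] ind_s.
  have [t [tfix sK tK]] := fixing_inv sfix.
  apply: (Npsi (t \o b')).
    apply/(psiE id) => //; move/(automorphism_sat _ _ tfix.1): psi_s.
    by apply: (sat_eq _ _).1 => -[[i|p]|] //=; rewrite sK.
  have ssa : small K (s @` (a `|` [set c])) by apply: small_image.
  have := ind_fixing (small_tuple b') A_small ssa tfix ind_s.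
  by rewrite (imageK _ sK) -range_comp.
Qed.

End Formula.

(** * The coding configuration *)

(** Each failing instance is excluded by one of the two independences that
[coding_element] provides for [z t s]: if [v < t < u], then [y u] and [z t s]
together are independent from the [v]-th copy of [a]; if [s < u], then [y u] is
independent from the [t]-th copy of [a] together with [z t s]. *)
Lemma coding_configuration (a b : set M) (c : M) :
  bounded K ind -> extension_base K ind A -> left_extension_over K ind A ->
  small K a -> small K b -> ind b A a ->
  ~ ind (b `|` [set c]) A a -> ~ ind b A (a `|` [set c]) ->
  exists (n : nat) (Y : Type) (theta : formula L ('I_n + Y + unit))
    (y : nat -> 'I_n -> M) (x : nat -> Y -> M) (z : nat -> nat -> M),
  let Theta u v t s := sat (triple_env (y u) (x v) (z t s)) theta in
  [/\ forall t s, t < s -> Theta s t t s,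
      forall v t s u, v < t -> t < s -> t < u -> ~ Theta u v t s
    & forall t s u, t < s -> s < u -> ~ Theta u t t s].
Proof.
move=> bnd base lext sa sb ba Nbc_a Nb_ac.
have sbc : small K (b `|` [set c]) by apply: small_setU1.
have sac : small K (a `|` [set c]) by apply: small_setU1.
have [F1 [F1fin F1bc NF1]] := ind_finite_character sbc A_small sa Nbc_a.
have [F2 [F2fin F2b NF2]] := ind_finite_character sb A_small sac Nb_ac.
have [|n [b0 b0E]] := @finite_range ((F1 `&` b) `|` F2).
  by rewrite finite_setU; split=> //; apply: finite_setIl.
have b0b : range b0 `<=` b by rewrite b0E => x [[]|/F2b].
have sb0 := small_tuple b0.
have b0a : ind (range b0) A a by apply: ind_mono ba.
have [||theta [theta0 theta_left theta_right]] := @dependence_formula a n b0 c sa.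
- apply: contra_not NF1; apply: ind_mono => //; first exact: small_setU1.
  by move=> x F1x; have [bx|] := F1bc x F1x; [left; rewrite b0E; left|right].
- by apply: contra_not NF2; apply: ind_mono => // x F2x; rewrite b0E; right.
have [sg [bh [sgA copies sameP]]] := independent_copies sa b0a bnd base.
pose dh := range bh `|` a.
have sdh : small K dh by apply: small_setU => //; apply: small_tuple.
pose e0 := @set_val _ (A `|` a).
pose seg := segment sg dh.
have /choice[z zP] (p : nat * nat) : exists z : M, p.1 < p.2 ->
    exists u, [/\ fixing A u, u \o b0 = sg p.2 \o bh, u \o e0 = sg p.1 \o e0, u c = z &
      ind (seg [set j | p.2 < j]) A (seg `I_p.2.+1 `|` [set z]) /\
      ind (seg [set j | p.1 <= j] `|` [set z]) A (seg `I_p.1)].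
  case: p => t s /=; have [ts|] := ltnP t s; last by exists c.
  have [r [rfix rb0 re0]] := sameP _ _ ts.
  have [u [ufix right left]] := coding_element sdh copies c lext (ltnW ts) rfix.
  exists (u (r c)) => _; exists (u \o r); split=> //.
  - by apply: fixing_comp rfix; apply: fixing_sub ufix => x; left.
  - rewrite -[LHS]/(u \o (r \o b0)) rb0; apply: funext => i /=; apply: ufix.2.
    right; exists s; first by rewrite /= leqnn ltnW.
    by exists (bh i) => //; left; exists i.
  - rewrite -[LHS]/(u \o (r \o e0)) re0; apply: funext => i /=; apply: ufix.2.
    have [Ai|ai] := set_valP i; first by left; rewrite (sgA t).2.
    by right; exists t; [rewrite /= leqnn ltnW|exists (e0 i) => //; right].
have bh_dh j : range (sg j \o bh) `<=` sg j @` dh.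
  by move=> _ [i _ <-]; exists (bh i) => //; left; exists i.
have sseg P : small K (seg P) by apply: segment_small.
exists n, (set_type (A `|` a)), theta, (fun s => sg s \o bh), (fun t => sg t \o e0),
  (fun t s => z (t, s)); split.
- move=> t s ts; have [u [ufix <- <- <- _]] := zP (t, s) ts.
  move/(automorphism_sat _ _ ufix.1): theta0.
  by apply: (sat_eq _ _).1 => -[[]|].
- move=> v t s u vt ts tu; have [_ [_ _ _ _ [_ left]]] := zP (t, s) ts.
  move=> /(theta_left _ _ _ (sgA v)); apply.
  apply: (ind_mono _ _ _ _ _ left) => //; first exact: small_setU1.
    move=> x [/bh_dh xu|->]; last by right.
    by left; exists u => //=; apply: ltnW.
  by move=> _ [x ax <-]; exists v => //; exists x => //; right.
- move=> t s u ts su; have [w [wfix _ we0 wc [right _]]] := zP (t, s) ts.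
  rewrite -we0 -[z (t, s)]wc => /(theta_right _ _ wfix); apply.
  apply: (ind_mono _ _ _ _ _ right) => //; first exact: small_setU1.
    by move=> x /bh_dh xu; exists u.
  rewrite image_setU image_set1 wc => x [[y ay <-]|->]; last by right.
  left; exists t; first by rewrite /=; lia.
  have wE : w y = sg t y by have := congr1 (@^~ (set_elem (or_intror ay : (A `|` a) y))) we0.
  by rewrite wE; exists y => //; right.
Qed.

End Tuples.
End Independence.

(** * Coding contradicts monadic NIP *)

(** The set of coding elements [z t s] given by [coding_pattern] for the digit
graph is named by a unary predicate. The shattering formula says that some
element of the predicate codes the pair; its variables range over tuples
together with their neighbours in the sequence. *)
Lemma coding_not_monadically_NIP L (T : theory L) (M : structure L)
    n (Y : Type) (theta : formula L ('I_n + Y + unit))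
    (y : nat -> 'I_n -> M) (x : nat -> Y -> M) (z : nat -> nat -> M) :
  let Theta u v t s := sat (triple_env (y u) (x v) (z t s)) theta in
  models M T ->
  (forall t s, t < s -> Theta s t t s) ->
  (forall v t s u, v < t -> t < s -> t < u -> ~ Theta u v t s) ->
  (forall t s u, t < s -> s < u -> ~ Theta u t t s) ->
  ~ monadically_NIP T.
Proof.
move=> Theta MT diag left right mnip.
have [f [f' [g [g' codes]]]] := coding_pattern diag left right.
have [Z ZP] := codes (fun i j => odd (j %/ 2 ^ i)).
pose U (_ : unit) : set M := [set w | exists t s, Z t s /\ z t s = w].
pose sub_var (hb : 'I_n -> 'I_n + 'I_n) (hx : Y -> Y + Y) (v : 'I_n + Y + unit) :
    option ((Y + Y) + ('I_n + 'I_n)) :=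
  match v with
  | inl (inl i) => Some (inr (hb i))
  | inl (inr j) => Some (inl (hx j))
  | inr _ => None
  end.
pose copy hb hx := rename (sub_var hb hx) (lift_formula unit theta).
pose chi := FEx (FAnd
  (@FRel (unary_language L unit) _ (inr tt) (fun=> TVar _ None))
  (FAnd (copy inl inl) (FAnd (FNot (copy inl inr)) (FNot (copy inr inl))))).
apply: (@shattering_not_NIP _ (unary_expansion U) _ _ chi
  (fun i => sum_env (x (f i)) (x (f' i)))); last exact: mnip.
move=> N S; have [j Nj jS] := binary_digits S N.
exists (sum_env (y (g j)) (y (g' j))) => i iN.
rewrite -jS // ZP; last exact: leq_trans iN Nj.
have copyE (w : M) hb hx :
    @sat _ (unary_expansion U) _ (fun v => if v is Some v' then
      sum_env (sum_env (x (f i)) (x (f' i))) (sum_env (y (g j)) (y (g' j))) v' else w)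
      (copy hb hx) <->
    sat (triple_env (sum_env (y (g j)) (y (g' j)) \o hb)
                    (sum_env (x (f i)) (x (f' i)) \o hx) w) theta.
  by rewrite /copy sat_rename -(sat_lift U); apply: sat_eq => -[[]|[]].
rewrite /chi sat_ex; split=> [[w]|[t [s [Zts T1 T2 T3]]]].
  rewrite !sat_and !sat_not !copyE => -[/= [t [s [Zts <-]]] [T1 [T2 T3]]].
  by exists t, s.
exists (z t s); rewrite !sat_and !sat_not !copyE; split=> //.
by exists t, s.
Qed.

Theorem theorem3p3 (L : language) (T : theory L) (M : structure L) (K : Type)
    (ind : set M -> set M -> set M -> Prop) (A : set M) :
  complete_theory T ->
  monster K T M ->
  monadically_NIP T ->
  standard_preindependence K ind ->
  bounded K ind ->
  small K A ->
  extension_base K ind A ->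
  left_extension_over K ind A ->
  BS_trivial_over K ind A.
Proof.
move=> _ [MT Lsmall Klim _ Khom] mnip [[inv mon sfc] [bas ltr rex]] bnd sA base lext.
move=> a b c sa sb ba; apply: contrapT => /not_orP[Nbc_a Nb_ac].
have Knat : small K [set: nat].
  apply: small_le Lsmall.
  by apply: (@card_le_injective _ _ _ _ (fun n => FEq (TVar L n) (TVar L n)))
    => // i j _ _ [].
have [n [Y [theta [y [x [z [diag left right]]]]]]] :=
  coding_configuration Klim Knat Khom inv mon sfc bas ltr rex sA bnd base lext
    sa sb ba Nbc_a Nb_ac.
exact: coding_not_monadically_NIP MT diag left right mnip.
Qed.
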